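(* For every $\alpha\ge 1$, the minimum $$\min_{L,\ |L|=1}\ \sum_{\mathbb{P}\in L}|\mathbb{P}|^2e^{-\pi\alpha|\mathbb{P}|^2}$$ over all two-dimensional lattices $L\subset\mathbb{R}^2$ of unit area is achieved at the hexagonal lattice.
   Context: A two-dimensional lattice is a set $\mathbb{Z}\vec u\oplus\mathbb{Z}\vec v$ with $\vec u,\vec v\in\mathbb{R}^2$ linearly independent; $|L|=1$ means that its unit cell has area $1$. Up to rotation/reflection such lattices are $L_z=\sqrt{\frac{1}{\Im(z)}}(\mathbb{Z}\oplus z\mathbb{Z})$, $z\in\mathbb{H}=\{z\in\mathbb{C}:\Im z>0\}$. The hexagonal lattice of unit area is $\Lambda_1=\sqrt{\frac{2}{\sqrt3}}\,\big[\mathbb{Z}(1,0)\oplus\mathbb{Z}(\frac12,\frac{\sqrt3}{2})\big]$, corresponding to $z=e^{i\pi/3}$. $|\cdot|$ is the Euclidean norm. *)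

(* Defs.v *)
From HB Require Import structures.
From mathcomp Require Import all_boot all_order all_algebra.
From mathcomp Require Import all_classical all_reals all_analysis.

Set Implicit Arguments.
Unset Strict Implicit.
Unset Printing Implicit Defensive.

Import Order.TTheory GRing.Theory Num.Theory.

Local Open Scope classical_set_scope.
Local Open Scope ring_scope.

Section Lattices.
Variable R : realType.
Implicit Types (u v p : 'rV[R]_2) (L : set 'rV[R]_2).

Definition vec2 (x y : R) : 'rV[R]_2 := \row_j (if j == 0 then x else y).

(* The library norm on 'rV[R]_2 is the sup norm, hence this definition. *)
Definition enorm p : R := Num.sqrt (\sum_i p 0 i ^+ 2).

Definition zspan u v : set 'rV[R]_2 :=
  [set p | exists m n : int, p = u *~ m + v *~ n].

Definition lattice_basis u v L : Prop := free [:: u; v] /\ L = zspan u v.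

Definition cell_area u v : R := `| \det (col_mx u v : 'M[R]_2) |.

(* The area of the unit cell does not depend on the basis: two bases differ by
   an integer matrix of determinant 1 or -1. *)
Definition unit_area_lattice L : Prop :=
  exists u v, lattice_basis u v L /\ cell_area u v = 1.

Definition hexagonal_lattice : set 'rV[R]_2 :=
  [set Num.sqrt (2 / Num.sqrt 3) *: p
     | p in zspan (vec2 1 0) (vec2 (1 / 2) (Num.sqrt 3 / 2))].

(* The terms are nonnegative, so the unordered sum is a supremum of finite
   partial sums, in the extended reals. *)
Definition lattice_energy (alpha : R) L : \bar R :=
  \esum_(p in L) (enorm p ^+ 2 * expR (- (pi * alpha * enorm p ^+ 2)))%:E.

End Lattices.

Arguments hexagonal_lattice : clear implicits.

(* Main.v *)
Require Import Defs.
From HB Require Import structures.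
From mathcomp Require Import all_boot all_order all_algebra.
From mathcomp Require Import all_classical all_reals all_analysis.
From mathcomp Require Import ring lra zify.

(** Write b = pi alpha, so that b >= 157/50, and G(t) = t e^(-b t), the [weight].
    A lattice of unit area with basis (u, v) has energy sum G(q(m, n)) over the
    integer pairs, where q(m, n) = x m^2 + 2 B m n + y n^2 with x = |u|^2,
    B = u.v, y = |v|^2 and x y - B^2 = 1.  Let t = 2 / sqrt 3, so that the
    hexagonal lattice has the form t N with N = m^2 + m n + n^2.  A basis
    minimising |u|^2 + |v|^2 is reduced: up to sign and order,
    0 <= 2 B <= x <= y ([exists_reduced_form]).  Put z = x + y - 2 B and
    w = x + y + 2 B, the squared lengths of u - v and u + v.

    Suppose first that z <= 1.45 and x >= 0.62, that is, the lattice is close to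
    the hexagonal one.  The rotation of order six of the hexagonal form permutes
    the integer pairs, and along p, rho p, rho^2 p the form q takes the squared
    side lengths of a triangle of the same area as the equilateral triangle of
    squared side T = t N(p).  It is enough to show that each such triple
    contributes at least 3 G(T) ([form_energy_orbits]).  If N(p) >= 2, then
    b T >= 7, and a parabola below the rescaled weight has its coefficients
    matched to Heron's formula, so that the three bounds add up to 3 G(T)
    ([weight_orbit_ge]).  If N(p) = 1, the triangle has squared sides x, y, z; it
    can be replaced by the isosceles triangle of base z and the same area
    ([weight_symmetrize]), and then z can be lowered to t
    ([weight_isosceles_low]).

    Otherwise a few short vectors of the lattice already have more energy than the
    whole hexagonal lattice, whose energy is at most 6 (1 + 1/200) G(t)
    ([hex_energy_le]).  For z >= 1.45 these are the vectors of squared lengths x,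
    y, z, w: symmetrising, which is legitimate also in the presence of w, leaves a
    function of z alone, invariant under exchange of z and 4/z
    ([weight_isosceles_high]).  For x < 0.62 they are multiples of the shortest
    vector, or the shortest vector and the second basis vector
    ([weight_short_pair], [weight_short_with_second]).

    The hard inequality is the monotonicity behind [weight_symmetrize].  It
    reduces to the single value b = 157/50 by [slope_ratio_le], then, with a Pade
    bound of the exponential, to the positivity of a polynomial
    ([pade_gap_ge_diagonal_cap]). *)

Set Implicit Arguments.
Unset Strict Implicit.
Unset Printing Implicit Defensive.

Import Order.TTheory GRing.Theory Num.Theory.
Import numFieldNormedType.Exports.

Local Open Scope classical_set_scope.
Local Open Scope ring_scope.

(** * A lower bound for pi *)

Section PiBound.
Variable R : realType.
Implicit Types (x : R).

Lemma le_of_derive_ge0 (f df : R -> R) (a b : R) : a <= b ->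
  (forall x, a <= x <= b -> is_derive x 1 f (df x)) ->
  (forall x, a <= x <= b -> 0 <= df x) -> f a <= f b.
Proof.
move=> ab fdf df0.
have [||c] := @MVT_segment R f df a b ab.
- by move=> x xab; apply: fdf; move: xab; rewrite in_itv /= => /andP[? ?]; lra.
- apply: derivable_within_continuous => x; rewrite in_itv /= => xab.
  exact: (@ex_derive _ _ _ _ _ _ _ (fdf x xab)).
rewrite in_itv /= => cab E; rewrite -subr_ge0 E mulr_ge0 ?df0 // subr_ge0 //.
Qed.

Lemma sin_le_id x : 0 <= x -> sin x <= x.
Proof.
move=> x0.
have := @le_of_derive_ge0 (fun t => t - sin t) (fun t => 1 - cos t) 0 x x0.
rewrite sin0 subrr subr_ge0; apply => t _; last by rewrite subr_ge0 cos_le1.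
Qed.

Lemma cos_ge_quad x : 0 <= x -> 1 - x ^+ 2 / 2 <= cos x.
Proof.
move=> x0.
have := @le_of_derive_ge0 (fun t => cos t + t ^+ 2 / 2) (fun t => t - sin t) 0 x x0.
rewrite cos0 expr0n /= mul0r addr0 -lerBlDr; apply => t /andP[t0 _].
  apply: is_derive_eq.
  by rewrite /GRing.scale /=; field.
by rewrite subr_ge0 sin_le_id.
Qed.

(** With d = 1 - cos x, the formula cos 2x = 2 (cos x)^2 - 1 reads
    1 - cos 2x = 4 d - 2 d^2, which increases in d on d <= 1. *)
Lemma cos_double_ge (d d' x : R) : d <= 1 -> 4 * d - 2 * d ^+ 2 <= d' ->
  1 - d <= cos x -> 1 - d' <= cos (x *+ 2).
Proof.
move=> d1 dd' cx; rewrite cos_mulr2n.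
have : (1 - d) ^+ 2 <= cos x ^+ 2 by rewrite lerXn2r // nnegrE; lra.
lra.
Qed.

(** The cosine is shown to be positive at 157/100: the quadratic bound is
    sharp at 157/6400, and the angle is then doubled six times. Each rational
    number is 4 d - 2 d^2 for the previous d, rounded up. *)
Lemma pi_ge : 157 / 50 <= pi :> R.
Proof.
rewrite leNgt; apply/negP => lt_pi.
suff cos_ge : 1 - 4998 / 1000 / 5 <= cos (157 / 100 : R).
  have : cos (157 / 100) < cos (pi / 2) :> R.
    by rewrite ltr_cos ?in_itv /=; have := @pi_ge2 R; lra.
  by rewrite cos_pihalf; lra.
have -> : (157 / 100 : R) = (157 / 64 / 100) *+ 2 *+ 2 *+ 2 *+ 2 *+ 2 *+ 2.
  by rewrite -!mulrnA -mulr_natr /=; clear; lra.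
clear lt_pi.
apply: (cos_double_ge (d := 1171 / 1000 / 4)); [lra|lra|].
apply: (cos_double_ge (d := 1902 / 1000 / 25)); [lra|lra|].
apply: (cos_double_ge (d := 4801 / 1000 / 250)); [lra|lra|].
apply: (cos_double_ge (d := 1203 / 1000 / 250)); [lra|lra|].
apply: (cos_double_ge (d := 2407 / 1000 / 20 / 100)); [lra|lra|].
apply: (cos_double_ge (d := 3009 / 1000 / 100 / 100)); [lra|lra|].
by apply: le_trans (cos_ge_quad _); lra.
Qed.

End PiBound.

(** * Bounds for the exponential *)

Section ExpBounds.
Variable R : realType.
Implicit Types (x e s u v t : R).

Lemma ge0_of_derive (f df : R -> R) : f 0 = 0 ->
  (forall x, is_derive x 1 f (df x)) -> (forall x, 0 <= x -> 0 <= df x) ->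
  forall x, 0 <= x -> 0 <= f x.
Proof.
move=> f0 fdf df0 x x0; rewrite -f0.
apply: (@le_of_derive_ge0 _ f df 0 x x0) => t /andP[t0 _]; exact: df0.
Qed.

Lemma expR_ge_series v n : 0 <= v -> series (exp_coeff v) n <= expR v.
Proof.
move=> v0; apply: nondecreasing_cvgn_le; last exact: is_cvg_series_exp_coeff.
by apply: nondecreasing_series => k _ _; rewrite /exp_coeff /= divr_ge0 ?exprn_ge0.
Qed.

Lemma expR_ge_quartic v : 0 <= v ->
  1 + v + v ^+ 2 / 2 + v ^+ 3 / 6 + v ^+ 4 / 24 <= expR v.
Proof.
move=> v0; apply: le_trans (expR_ge_series 5 v0).
rewrite /series /= !big_nat_recr //= big_geq // /exp_coeff /= !factS fact0 expr0 expr1.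
lra.
Qed.

Lemma expRN_ge_cubic v : 0 <= v -> 1 - v + v ^+ 2 / 2 - v ^+ 3 / 6 <= expR (- v).
Proof.
move=> v0; rewrite -subr_ge0.
pose f t := expR (- t) - (1 - t + t ^+ 2 / 2 - t ^+ 3 / 6).
rewrite -/(f v).
pose f1 t := - expR (- t) + 1 - t + t ^+ 2 / 2.
pose f2 t := expR (- t) - 1 + t.
move: v v0; apply: (@ge0_of_derive f f1).
- by rewrite /f oppr0 expR0 !expr0n /=; lra.
- move=> x; apply: is_derive_eq.
  by rewrite /f1 /GRing.scale /=; field.
apply: (@ge0_of_derive f1 f2).
- by rewrite /f1 oppr0 expR0 !expr0n /=; lra.
- move=> x; apply: is_derive_eq.
  by rewrite /f2 /GRing.scale /=; field.
by move=> x _; rewrite /f2; have := expR_ge1Dx (- x); lra.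
Qed.

(** The [4/4] Pade approximant of the exponential is a lower bound.
    Each derivative of the difference is again an exponential times a quartic
    minus a polynomial, one degree lower, and vanishes at 0; after five steps only
    e^t t^4 is left. *)
Lemma expR_ge_pade v : 0 <= v ->
  1680 + 840 * v + 180 * v ^+ 2 + 20 * v ^+ 3 + v ^+ 4
  <= expR v * (1680 - 840 * v + 180 * v ^+ 2 - 20 * v ^+ 3 + v ^+ 4).
Proof.
pose f0 t := expR t * (1680 - 840 * t + 180 * t ^+ 2 - 20 * t ^+ 3 + t ^+ 4) - (1680 + 840 * t
    + 180 * t ^+ 2 + 20 * t ^+ 3 + t ^+ 4).
pose f1 t := expR t * (840 - 480 * t + 120 * t ^+ 2 - 16 * t ^+ 3 + t ^+ 4) - (840 + 360 * t
    + 60 * t ^+ 2 + 4 * t ^+ 3).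
pose f2 t := expR t * (360 - 240 * t + 72 * t ^+ 2 - 12 * t ^+ 3 + t ^+ 4) - (360 + 120 * t
    + 12 * t ^+ 2).
pose f3 t := expR t * (120 - 96 * t + 36 * t ^+ 2 - 8 * t ^+ 3 + t ^+ 4) - (120 + 24 * t).
pose f4 t := expR t * (24 - 24 * t + 12 * t ^+ 2 - 4 * t ^+ 3 + t ^+ 4) - 24.
pose f5 t := expR t * t ^+ 4 - 0.
move=> v0; rewrite -subr_ge0 -/(f0 v).
move: v v0; apply: (@ge0_of_derive f0 f1).
- by rewrite /f0 expR0 !expr0n /=; lra.
- by move=> x; apply: is_derive_eq; rewrite /f1 /GRing.scale /=; ring.
apply: (@ge0_of_derive f1 f2).
- by rewrite /f1 expR0 !expr0n /=; lra.
- by move=> x; apply: is_derive_eq; rewrite /f2 /GRing.scale /=; ring.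
apply: (@ge0_of_derive f2 f3).
- by rewrite /f2 expR0 !expr0n /=; lra.
- by move=> x; apply: is_derive_eq; rewrite /f3 /GRing.scale /=; ring.
apply: (@ge0_of_derive f3 f4).
- by rewrite /f3 expR0 !expr0n /=; lra.
- by move=> x; apply: is_derive_eq; rewrite /f4 /GRing.scale /=; ring.
apply: (@ge0_of_derive f4 f5).
- by rewrite /f4 expR0 !expr0n /=; lra.
- by move=> x; apply: is_derive_eq; rewrite /f5 /GRing.scale /=; ring.
move=> x x0; rewrite /f5 subr0 mulr_ge0 ?expR_ge0 ?exprn_ge0 //.
Qed.

(** Scaling the argument by n sharpens the Taylor bound: it is used at v and
    raised to the power n. *)
Lemma expR_ge_pow n (v e : R) : 0 <= v ->
  e <= (1 + v + v ^+ 2 / 2 + v ^+ 3 / 6 + v ^+ 4 / 24) ^+ n -> e <= expR (n%:R * v).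
Proof.
move=> v0 /le_trans; apply.
rewrite expRM_natl lerXn2r ?nnegrE ?expR_ge0 ?expR_ge_quartic //.
have := exprn_ge0 2 v0; have := exprn_ge0 3 v0; have := exprn_ge0 4 v0; lra.
Qed.

Lemma expRN_ge_pow n v e : 0 <= v -> 0 <= 1 - v + v ^+ 2 / 2 - v ^+ 3 / 6 ->
  e <= (1 - v + v ^+ 2 / 2 - v ^+ 3 / 6) ^+ n -> e <= expR (- (n%:R * v)).
Proof.
move=> v0 c0 /le_trans; apply.
rewrite -[- (n%:R * v)]mulrN expRM_natl lerXn2r ?nnegrE ?expR_ge0 //.
exact: expRN_ge_cubic.
Qed.

(** Tangent line of the exponential at s, with a lower bound e in place of
    e^s. Where the line is negative the replacement costs nothing. *)
Lemma expR_tangent e s u : 0 <= e -> e <= expR s -> e * (1 + (u - s)) <= expR u.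
Proof.
move=> e0 es; have E := expR_ge1Dx (u - s).
have -> : expR u = expR s * expR (u - s) by rewrite -expRD; congr expR; ring.
have [pos|/ltW neg] := leP 0 (1 + (u - s)).
  apply: (@le_trans _ _ (expR s * (1 + (u - s)))); first by rewrite ler_wpM2r.
  by rewrite ler_wpM2l ?expR_ge0.
apply: (@le_trans _ _ 0); first by rewrite mulr_ge0_le0.
by rewrite mulr_ge0 ?expR_ge0.
Qed.

End ExpBounds.

(** * The weight, and triangles of given area *)

Section Weight.
Variable R : realType.
Implicit Types (b c d e s t u x y tau T : R).

Definition weight b t : R := t * expR (- (b * t)).

Lemma weight_ge0 b t : 0 <= t -> 0 <= weight b t.
Proof. by move=> t0; rewrite /weight mulr_ge0 ?expR_ge0. Qed.

(** The weight decreases beyond its maximum, which is at 1 / b. *)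
Lemma weight_antitone b s t : 0 < s -> 1 <= b * s -> s <= t -> weight b t <= weight b s.
Proof.
move=> s0 bs st; rewrite /weight.
have -> : - (b * s) = - (b * t) + b * (t - s) by ring.
rewrite expRD.
have := expR_ge1Dx (b * (t - s)); have := expR_gt0 (- (b * t)).
set F := expR (- _); set E := expR _ => F0 hE.
rewrite mulrC [leRHS]mulrCA ler_pM2l //.
have : s * (1 + b * (t - s)) <= s * E by rewrite ler_pM2l.
nra.
Qed.

Lemma is_derive_weight b (f : R -> R) (df t : R) : is_derive t 1 f df ->
  is_derive t 1 (fun t => weight b (f t)) (df * ((1 - b * f t) * expR (- (b * f t)))).
Proof.
move=> fdf; rewrite /weight.
apply: is_derive_eq.
rewrite /GRing.scale /=; ring.
Qed.

(** The tangent line of the exponential at s, applied to e^(b (t - c)). As d may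
    be affine in b, sums of weights can be compared for all b at once, relative to
    the common factor e^(-b t). *)
Lemma weight_tangent b t c e d s : 0 < c -> 0 <= e -> e <= expR s -> d <= b * (t - c) - s ->
  c * e * (1 + d) * expR (- (b * t)) <= weight b c.
Proof.
move=> c0 e0 es dle.
rewrite /weight -!mulrA ler_pM2l // mulrA.
have -> : - (b * c) = b * (t - c) - b * t by ring.
rewrite expRD ler_wpM2r ?expR_ge0 //.
apply: le_trans (expR_tangent (b * (t - c)) e0 es).
by rewrite ler_wpM2l // lerD2l.
Qed.

(** The ratio (b y - 1) e^(-b y) / ((b x - 1) e^(-b x)) of the slopes of the
    weight decreases in b, because both (b y - 1) / (b x - 1) and e^(-b (y - x))
    do. Inequalities that bound slopes at larger arguments by the slope at the
    smallest one therefore need to be checked only for the smallest b. *)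
Lemma slope_ratio_le b0 b x y : b0 <= b -> x <= y -> 1 < b0 * x -> 0 < x ->
  (b * y - 1) * expR (- (b * (y - x))) * (b0 * x - 1) <=
  (b0 * y - 1) * expR (- (b0 * (y - x))) * (b * x - 1).
Proof.
move=> bb xy b0x x0.
have c : (b * y - 1) * (b0 * x - 1) <= (b0 * y - 1) * (b * x - 1).
  have : 0 <= (b - b0) * (y - x) by rewrite mulr_ge0 // subr_ge0.
  lra.
have e : expR (- (b * (y - x))) <= expR (- (b0 * (y - x))).
  by rewrite ler_expR lerN2 ler_wpM2r // subr_ge0.
have bx : b0 * x <= b * x by rewrite ler_wpM2r // ltW.
have b_pos : 0 < b by nra.
have by_ : b * x <= b * y by rewrite ler_pM2l.
have := @ler_pM _ ((b * y - 1) * (b0 * x - 1)) _ (expR (- (b * (y - x)))) _ _ (expR_ge0 _) c e.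
have p : 0 <= (b * y - 1) * (b0 * x - 1) by rewrite mulr_ge0 //; lra.
move=> /(_ p); lra.
Qed.

(** The parabola is tangent to the left-hand side at u = 0: both have value
    1 and slope -(tau - 1) there, and half the second derivatives differ by
    tau^2 / 2 - 2 tau + 1, which is positive with room to spare for tau >= 7. The
    quadratic coefficient is chosen opposite to the linear one, which is what the
    Heron relation of [weight_orbit_ge] requires. *)
Lemma expR_quadratic_bound tau u : 7 <= tau -> - (1 / 2) <= u <= 3 / 5 ->
  1 - (tau - 1) * u + (tau - 1) * u ^+ 2 <= (1 + u) * expR (- (tau * u)).
Proof.
move=> tau7 /andP[ulo uhi].
have [u0|/ltW u0] := leP 0 u.
- have [s_small|s_big] := leP (tau * u) (3 / 2).
    have s0 : 0 <= tau * u by nra.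
    have := expRN_ge_cubic s0.
    move: (expR _) => E hE.
    have {hE} : (1 + u) * (1 - tau * u + (tau * u) ^+ 2 / 2 - (tau * u) ^+ 3 / 6) <= (1 + u) * E.
      by rewrite ler_pM2l //; lra.
    apply: le_trans; rewrite -subr_ge0.
    set s := tau * u in s0 s_small *.
    have -> : (1 + u) * (1 - s + s ^+ 2 / 2 - s ^+ 3 / 6) -
       (1 - (tau - 1) * u + (tau - 1) * u ^+ 2) =
       u ^+ 2 * (tau ^+ 2 * (1 / 2 - s / 6) - 2 * tau + 1 + tau * (s * (1 / 2 - s / 6))).
      by rewrite /s; field.
    apply: mulr_ge0; first exact: sqr_ge0.
    have h1 : 0 <= s * (1 / 2 - s / 6) by apply: mulr_ge0; lra.
    have h2 : tau ^+ 2 * (1 / 4) <= tau ^+ 2 * (1 / 2 - s / 6).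
      by rewrite ler_wpM2l ?sqr_ge0 //; lra.
    have h3 : 0 <= tau * (s * (1 / 2 - s / 6)) by apply: mulr_ge0; lra.
    have h4 : s * (1/8) <= s * (1 / 2 - s / 6) by rewrite ler_wpM2l //; lra.
    nra.
  (* Here the parabola is nonpositive: (tau - 1) (u - u^2) >= 1. *)
  have : 0 <= (1 + u) * expR (- (tau * u)) by apply: mulr_ge0; [lra|exact: expR_ge0].
  apply: le_trans.
  have [u_big|u_small] := leP (3 / 14) u; last by nra.
  have : 1 <= 6 * (u - u ^+ 2) by nra.
  have : 6 * (u - u ^+ 2) <= (tau - 1) * (u - u ^+ 2) by rewrite ler_wpM2r //; nra.
  lra.
- have [v vE] : exists v, v = - u by exists (- u).
  have -> : u = - v by rewrite vE opprK.
  rewrite [tau * _]mulrN opprK.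
  have v0 : 0 <= v by lra.
  have v1 : v <= 1 / 2 by lra.
  have s0 : 0 <= tau * v by nra.
  have := expR_ge_quartic s0.
  move: (expR _) => E hE.
  have {hE} : (1 - v) * (1 + tau * v + (tau * v) ^+ 2 / 2 + (tau * v) ^+ 3 / 6) <= (1 - v) * E.
    rewrite ler_pM2l; last by lra.
    by apply: le_trans hE; rewrite lerDl divr_ge0 // exprn_ge0.
  apply: le_trans; rewrite -subr_ge0.
  have -> : (1 - v) * (1 + tau * v + (tau * v) ^+ 2 / 2 + (tau * v) ^+ 3 / 6) -
     (1 - (tau - 1) * - v + (tau - 1) * (- v) ^+ 2) =
     v ^+ 2 * ((tau ^+ 2 / 2 - 2 * tau + 1) + v * tau ^+ 2 * ((tau - 3 - v * tau) / 6)).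
    by field.
  apply: mulr_ge0; first exact: sqr_ge0.
  apply: addr_ge0; first by nra.
  apply: mulr_ge0; first by rewrite mulr_ge0 ?sqr_ge0.
  nra.
Qed.

(** The Heron relation says that t1, t2, t3 are the squared sides of a
    triangle with the area of the equilateral triangle of squared side T. With
    t_i = T (1 + u_i) it becomes sum u_i^2 = sum u_i + (sum u_i)^2 / 2, so that in
    the sum of the three parabolic bounds the linear terms cancel and
    3 + (b T - 1) (sum u_i)^2 / 2 is left. *)
Lemma weight_orbit_ge b T t1 t2 t3 : 0 < T -> 7 <= b * T ->
  T / 2 <= t1 <= 8 / 5 * T -> T / 2 <= t2 <= 8 / 5 * T -> T / 2 <= t3 <= 8 / 5 * T ->
  2 * (t1 * t2 + t2 * t3 + t3 * t1) - (t1 ^+ 2 + t2 ^+ 2 + t3 ^+ 2) = 3 * T ^+ 2 ->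
  3 * weight b T <= weight b t1 + weight b t2 + weight b t3.
Proof.
move=> T0 bT ht1 ht2 ht3 heron.
have scale t : weight b t =
    weight b T * ((1 + (t / T - 1)) * expR (- (b * T * (t / T - 1)))).
  rewrite /weight mulrACA -expRD; congr (_ * expR _); field; lra.
have wT : 0 < weight b T by rewrite /weight mulr_gt0 ?expR_gt0.
have bnd t : T / 2 <= t <= 8 / 5 * T ->
    1 - (b * T - 1) * (t / T - 1) + (b * T - 1) * (t / T - 1) ^+ 2 <=
    (1 + (t / T - 1)) * expR (- (b * T * (t / T - 1))).
  move=> /andP[tlo thi]; apply: expR_quadratic_bound => //.
  have : 1 / 2 <= t / T by rewrite ler_pdivlMr //; lra.
  have : t / T <= 8 / 5 by rewrite ler_pdivrMr.
  lra.
rewrite (scale t1) (scale t2) (scale t3) -!mulrDr mulrC ler_pM2l //.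
have := lerD (lerD (bnd t1 ht1) (bnd t2 ht2)) (bnd t3 ht3).
apply: le_trans.
have [u1 E1] : exists u, u = t1 / T - 1 by eexists.
have [u2 E2] : exists u, u = t2 / T - 1 by eexists.
have [u3 E3] : exists u, u = t3 / T - 1 by eexists.
rewrite -E1 -E2 -E3.
have F1 : t1 = T * (1 + u1) by rewrite E1; field; lra.
have F2 : t2 = T * (1 + u2) by rewrite E2; field; lra.
have F3 : t3 = T * (1 + u3) by rewrite E3; field; lra.
have key : u1 ^+ 2 + u2 ^+ 2 + u3 ^+ 2 = (u1 + u2 + u3) + (u1 + u2 + u3) ^+ 2 / 2.
  have T2 : T ^+ 2 != 0 by rewrite expf_neq0 //; lra.
  apply: (mulfI T2); move: heron; rewrite F1 F2 F3; lra.
have S0 : 0 <= (b * T - 1) * ((u1 + u2 + u3) ^+ 2 / 2).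
  by rewrite mulr_ge0 ?divr_ge0 ?sqr_ge0 //; lra.
have -> : 1 - (b * T - 1) * u1 + (b * T - 1) * u1 ^+ 2 +
  (1 - (b * T - 1) * u2 + (b * T - 1) * u2 ^+ 2) +
  (1 - (b * T - 1) * u3 + (b * T - 1) * u3 ^+ 2) =
  3 - (b * T - 1) * (u1 + u2 + u3) + (b * T - 1) * (u1 ^+ 2 + u2 ^+ 2 + u3 ^+ 2) by ring.
rewrite key; lra.
Qed.

(** As t2 and t3 vary, the Heron relation gives the quadratic inequality
    3 t1^2 - 2 (t1 + t2 + t3) t1 + 3 T^2 <= 0, which confines t1. *)
Lemma heron_range T t1 t2 t3 : 0 < T ->
  2 * (t1 * t2 + t2 * t3 + t3 * t1) - (t1 ^+ 2 + t2 ^+ 2 + t3 ^+ 2) = 3 * T ^+ 2 ->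
  0 <= t1 -> t1 + t2 + t3 <= (327 / 100) * T ->
  T / 2 <= t1 <= 8 / 5 * T.
Proof.
move=> T0 heron t10 hs.
have h : 3 * t1 ^+ 2 - 2 * (t1 + t2 + t3) * t1 + 3 * T ^+ 2 <= 0.
  by have := sqr_ge0 (t2 - t3); lra.
have h2 : (t1 + t2 + t3) * t1 <= 327 / 100 * T * t1 by rewrite ler_wpM2r.
apply/andP; split; nra.
Qed.

End Weight.

(** * Positivity of the Pade gap *)

Section PadeGap.
Variable R : realType.
Implicit Types (b t c lam h H X : R).

(** Let D(h) = 105 + 105 h + 45 h^2 + 10 h^3 + h^4, so that D(h) / D(-h) is the
    [4/4] Pade approximant of e^(2h), and let r = 1 / lam and X = X0 + r h^2. Then
    (lam - 2 h) (X - h) D(h) - (lam + 2 h) (X + h) D(-h) is 4 h times an even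
    polynomial in h; this is that polynomial, as a function of H = h^2. *)
Definition pade_gap lam r X0 H : R :=
  105 * ((lam / 2 - 1) * X0 - lam / 2)
  + (5 * lam * X0 + 315 / 2 - 45 * X0 - 45 / 2 * lam - 105 * r) * H
  + (15 - X0 - lam / 2 - 45 * r) * H ^+ 2 - r * H ^+ 3.

(** For lam in each of three intervals, the coefficients of 1, H and H^2 are
    bounded below by affine functions of mu, the distance of lam to the left
    endpoint (after multiplication by lam they are polynomials in lam). Close to
    the left endpoint of this first interval the gap is positive only for small H;
    this is the neighbourhood of the hexagonal lattice, where H is indeed small. *)
Lemma pade_gap_low lam r X0 H : lam * r = 1 -> lam * X0 = lam ^+ 2 / 4 + (157 / 50) ^+ 2 - lam ->
  362 / 100 <= lam <= 53 / 10 -> 0 <= H <= 165 / 100 * (lam - 362 / 100) ->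
  20 <= pade_gap lam r X0 H.
Proof.
move=> lr lX /andP[l0 l1] /andP[H0 H1].
have r0 : 0 < r by nra.
have [mu muE] : exists mu, mu = lam - 362 / 100 by eexists.
rewrite -muE in H1 *.
have mu0 : 0 <= mu by lra.
have mu1 : mu <= 168 / 100 by lra.
have lE : lam = 362 / 100 + mu by lra.
have c0 : 30 + 36 * mu <= 105 * ((lam / 2 - 1) * X0 - lam / 2).
  suff : 0 <= lam * (105 * ((lam / 2 - 1) * X0 - lam / 2) - 30 - 36 * mu) by rewrite pmulr_rge0; lra.
  have -> : lam * (105 * ((lam / 2 - 1) * X0 - lam / 2) - 30 - 36 * mu) =
     105 * ((lam / 2 - 1) * (lam * X0) - lam ^+ 2 / 2) - 30 * lam - 36 * mu * lam by field.
  have h1 := sqr_ge0 (mu - 1).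
  have h2 : 0 <= mu * (mu - 1) ^+ 2 by rewrite mulr_ge0.
  rewrite lX lE; nra.
have c1 : - (49 / 2) <= 5 * lam * X0 + 315 / 2 - 45 * X0 - 45 / 2 * lam - 105 * r.
  suff : 0 <= lam * (5 * lam * X0 + 315 / 2 - 45 * X0 - 45 / 2 * lam - 105 * r + 49 / 2)
      by rewrite pmulr_rge0; lra.
  have -> : lam * (5 * lam * X0 + 315 / 2 - 45 * X0 - 45 / 2 * lam - 105 * r + 49 / 2) =
   (5 * lam - 45) * (lam * X0) + 182 * lam - 45 / 2 * lam ^+ 2 - 105 * (lam * r) by field.
  rewrite lX lr lE; nra.
have c2 : - 2 + 2 * mu <= 15 - X0 - lam / 2 - 45 * r.
  suff : 0 <= lam * (15 - X0 - lam / 2 - 45 * r + 2 - 2 * mu) by rewrite pmulr_rge0; lra.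
  have -> : lam * (15 - X0 - lam / 2 - 45 * r + 2 - 2 * mu) =
    17 * lam - lam * X0 - lam ^+ 2 / 2 - 45 * (lam * r) - 2 * mu * lam by field.
  rewrite lX lr lE; nra.
have r1 : r <= 3 / 10 by nra.
rewrite /pade_gap.
move: (105 * _) (5 * lam * X0 + _ - _ - _ - _) (15 - _ - _ - _) c0 c1 c2 => C0 C1 C2 c0 c1 c2.
clear lr lX l0 l1 lE muE.
have : - (49 / 2) * H <= C1 * H by rewrite ler_wpM2r.
have : (- 2 + 2 * mu) * H ^+ 2 <= C2 * H ^+ 2 by rewrite ler_wpM2r ?sqr_ge0.
have : r * H ^+ 3 <= 3 / 10 * H ^+ 3 by rewrite ler_wpM2r ?exprn_ge0.
have : 20 <= 30 + 36 * mu - 49 / 2 * H + (- 2 + 2 * mu) * H ^+ 2 - 3 / 10 * H ^+ 3.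
  have h1 : 20 / 33 * H <= mu by lra.
  have h2 : 40 / 33 * H * H ^+ 2 <= 2 * mu * H ^+ 2 by rewrite ler_wpM2r ?sqr_ge0 //; lra.
  have h3 : 0 <= H * (H - 3 / 2) ^+ 2 by rewrite mulr_ge0 ?sqr_ge0.
  have h4 := sqr_ge0 (H - 2).
  nra.
lra.
Qed.

(** The factor 1 + 3 H / 10 comes from the decay of the diagonal term in H,
    see [diagonal_term_bound]; without it the bound fails at the far end of the
    range of H. *)
Lemma pade_gap_mid lam r X0 H : lam * r = 1 -> lam * X0 = lam ^+ 2 / 4 + (157 / 50) ^+ 2 - lam ->
  53 / 10 <= lam <= 6 -> 0 <= H <= 361 / 100 ->
  42 <= pade_gap lam r X0 H * (1 + 3 / 10 * H).
Proof.
move=> lr lX /andP[l0 l1] /andP[H0 H1].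
have r0 : 0 < r by nra.
have [mu muE] : exists mu, mu = lam - 53 / 10 by eexists.
have mu0 : 0 <= mu by lra.
have mu1 : mu <= 7 / 10 by lra.
have lE : lam = 53 / 10 + mu by lra.
have c0 : 99 + 44 * mu <= 105 * ((lam / 2 - 1) * X0 - lam / 2).
  suff : 0 <= lam * (105 * ((lam / 2 - 1) * X0 - lam / 2) - 99 - 44 * mu) by rewrite pmulr_rge0; lra.
  have -> : lam * (105 * ((lam / 2 - 1) * X0 - lam / 2) - 99 - 44 * mu) =
     105 * ((lam / 2 - 1) * (lam * X0) - lam ^+ 2 / 2) - 99 * lam - 44 * mu * lam by field.
  have h2 : 0 <= mu * mu ^+ 2 by rewrite mulr_ge0 ?sqr_ge0.
  rewrite lX lE; nra.
have c1 : - (222 / 10) - 74 / 10 * mu <= 5 * lam * X0 + 315 / 2 - 45 * X0 - 45 / 2 * lam - 105 * r.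
  suff : 0 <= lam * (5 * lam * X0 + 315 / 2 - 45 * X0 - 45 / 2 * lam - 105 * r + 222 / 10
      + 74 / 10 * mu) by rewrite pmulr_rge0; lra.
  have -> : lam * (5 * lam * X0 + 315 / 2 - 45 * X0 - 45 / 2 * lam - 105 * r + 222 / 10 + 74 / 10 * mu) =
   (5 * lam - 45) * (lam * X0) + (315 / 2 + 222 / 10
       + 74 / 10 * mu) * lam - 45 / 2 * lam ^+ 2 - 105 * (lam * r) by field.
  have h2 : 0 <= mu * mu ^+ 2 by rewrite mulr_ge0 ?sqr_ge0.
  rewrite lX lr lE; nra.
have c2 : 16 / 10 <= 15 - X0 - lam / 2 - 45 * r.
  suff : 0 <= lam * (15 - X0 - lam / 2 - 45 * r - 16 / 10) by rewrite pmulr_rge0; lra.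
  have -> : lam * (15 - X0 - lam / 2 - 45 * r - 16 / 10) =
    (15 - 16 / 10) * lam - lam * X0 - lam ^+ 2 / 2 - 45 * (lam * r) by field.
  rewrite lX lr lE; nra.
have r1 : r <= 19 / 100 by nra.
rewrite /pade_gap.
move: (105 * _) (5 * lam * X0 + _ - _ - _ - _) (15 - _ - _ - _) c0 c1 c2 => C0 C1 C2 c0 c1 c2.
clear lr lX l0 l1 lE muE.
have h1 : (- (222 / 10) - 74 / 10 * mu) * H <= C1 * H by rewrite ler_wpM2r.
have h2 : 16 / 10 * H ^+ 2 <= C2 * H ^+ 2 by rewrite ler_wpM2r ?sqr_ge0.
have h3 : r * H ^+ 3 <= 19 / 100 * H ^+ 3 by rewrite ler_wpM2r ?exprn_ge0.
have h4 : 0 <= mu * (44 - 74 / 10 * H) by rewrite mulr_ge0 //; lra.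
have h5 : 19 / 100 * H ^+ 3 <= 19 / 100 * 361 / 100 * H ^+ 2.
  have : H ^+ 3 <= 361 / 100 * H ^+ 2 by rewrite (exprS H 2) ler_wpM2r ?sqr_ge0.
  lra.
have h6 : 99 - 222 / 10 * H + (16 / 10 - 19 / 100 * 361 / 100) * H ^+ 2
    <= C0 + C1 * H + C2 * H ^+ 2 - r * H ^+ 3.
  lra.
apply: (@le_trans _ _ ((99 - 222 / 10 * H + (16 / 10 - 19 / 100 * 361 / 100) * H ^+ 2) * (1
    + 3 / 10 * H))).
  by nra.
by rewrite ler_wpM2r //; lra.
Qed.

Lemma pade_gap_high lam r X0 H : lam * r = 1 -> lam * X0 = lam ^+ 2 / 4 + (157 / 50) ^+ 2 - lam ->
  6 <= lam <= 704 / 100 -> 0 <= H <= 28 / 10 ->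
  90 <= pade_gap lam r X0 H * (1 + 3 / 10 * H).
Proof.
move=> lr lX /andP[l0 l1] /andP[H0 H1].
have r0 : 0 < r by nra.
have [mu muE] : exists mu, mu = lam - 6 by eexists.
have mu0 : 0 <= mu by lra.
have mu1 : mu <= 104 / 100 by lra.
have lE : lam = 6 + mu by lra.
have c0 : 134 + 54 * mu <= 105 * ((lam / 2 - 1) * X0 - lam / 2).
  suff : 0 <= lam * (105 * ((lam / 2 - 1) * X0 - lam / 2) - 134 - 54 * mu) by rewrite pmulr_rge0; lra.
  have -> : lam * (105 * ((lam / 2 - 1) * X0 - lam / 2) - 134 - 54 * mu) =
     105 * ((lam / 2 - 1) * (lam * X0) - lam ^+ 2 / 2) - 134 * lam - 54 * mu * lam by field.
  have h2 : 0 <= mu * mu ^+ 2 by rewrite mulr_ge0 ?sqr_ge0.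
  rewrite lX lE; nra.
have c1 : - (273 / 10) - 95 / 10 * mu <= 5 * lam * X0 + 315 / 2 - 45 * X0 - 45 / 2 * lam - 105 * r.
  suff : 0 <= lam * (5 * lam * X0 + 315 / 2 - 45 * X0 - 45 / 2 * lam - 105 * r + 273 / 10
      + 95 / 10 * mu) by rewrite pmulr_rge0; lra.
  have -> : lam * (5 * lam * X0 + 315 / 2 - 45 * X0 - 45 / 2 * lam - 105 * r + 273 / 10 + 95 / 10 * mu) =
   (5 * lam - 45) * (lam * X0) + (315 / 2 + 273 / 10
       + 95 / 10 * mu) * lam - 45 / 2 * lam ^+ 2 - 105 * (lam * r) by field.
  have h2 : 0 <= mu * mu ^+ 2 by rewrite mulr_ge0 ?sqr_ge0.
  rewrite lX lr lE; nra.
have c2 : 23 / 10 <= 15 - X0 - lam / 2 - 45 * r.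
  suff : 0 <= lam * (15 - X0 - lam / 2 - 45 * r - 23 / 10) by rewrite pmulr_rge0; lra.
  have -> : lam * (15 - X0 - lam / 2 - 45 * r - 23 / 10) =
    (15 - 23 / 10) * lam - lam * X0 - lam ^+ 2 / 2 - 45 * (lam * r) by field.
  rewrite lX lr lE; nra.
have r1 : r <= 17 / 100 by nra.
rewrite /pade_gap.
move: (105 * _) (5 * lam * X0 + _ - _ - _ - _) (15 - _ - _ - _) c0 c1 c2 => C0 C1 C2 c0 c1 c2.
clear lr lX l0 l1 lE muE.
have h1 : (- (273 / 10) - 95 / 10 * mu) * H <= C1 * H by rewrite ler_wpM2r.
have h2 : 23 / 10 * H ^+ 2 <= C2 * H ^+ 2 by rewrite ler_wpM2r ?sqr_ge0.
have h3 : r * H ^+ 3 <= 17 / 100 * H ^+ 3 by rewrite ler_wpM2r ?exprn_ge0.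
have h4 : 0 <= mu * (54 - 95 / 10 * H) by rewrite mulr_ge0 //; lra.
have h5 : 17 / 100 * H ^+ 3 <= 17 / 100 * 28 / 10 * H ^+ 2.
  have : H ^+ 3 <= 28 / 10 * H ^+ 2 by rewrite (exprS H 2) ler_wpM2r ?sqr_ge0.
  lra.
have h6 : 134 - 273 / 10 * H + (23 / 10 - 17 / 100 * 28 / 10) * H ^+ 2
    <= C0 + C1 * H + C2 * H ^+ 2 - r * H ^+ 3.
  lra.
apply: (@le_trans _ _ ((134 - 273 / 10 * H + (23 / 10 - 17 / 100 * 28 / 10) * H ^+ 2) * (1
    + 3 / 10 * H))).
  by nra.
by rewrite ler_wpM2r //; lra.
Qed.

End PadeGap.

(** * The energy slope of the long diagonal *)

Section DiagonalCap.
Variable R : realType.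
Implicit Types (b t s c lam h H X a : R).

(** The slope of the weight at w, relative to the factor e^(-b x), for the
    rhombus with squared side x = z / 4 + 1 / z and squared diagonals z and
    w = 4 / z: with b = 157/50 and lam = b z this is (b w - 1) e^(-b (w - x)). *)
Definition diagonal_cap lam : R :=
  weight (3 / 4) (4 * (157 / 50) ^+ 2 / lam - 1) * expR (lam / 4 - 3 / 4).

Lemma diagonal_cap_le lam l1 : 0 < lam -> lam <= l1 -> l1 <= 8 -> diagonal_cap lam <= diagonal_cap l1.
Proof.
move=> l0 ll l8.
have l10 : 0 < l1 by lra.
have a1 : 4 * (157 / 50) ^+ 2 / l1 - 1 >= 4 / 3 :> R.
  by rewrite lerBrDr ler_pdivlMr //; lra.
have aa : 4 * (157 / 50) ^+ 2 / l1 - 1 <= 4 * (157 / 50) ^+ 2 / lam - 1 :> R.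
  by rewrite lerB // ler_pM2l; [rewrite lef_pV2 // posrE|lra].
apply: ler_pM.
- by apply: mulr_ge0; [lra|exact: expR_ge0].
- exact: expR_ge0.
- by apply: weight_antitone => //; lra.
- by rewrite ler_expR; lra.
Qed.

(** Monotonicity in lam leaves the evaluation at the endpoint l1, where the
    exponential is bounded through n steps of size e. *)
Lemma diagonal_cap_le_taylor lam l1 a e n T : l1 > 0 -> 0 < lam -> lam <= l1 -> l1 <= 8 ->
  0 <= a -> 4 * (157 / 50) ^+ 2 / l1 - 1 = a -> 0 <= e ->
  n%:R * e <= 3 / 4 * (a + 1) - l1 / 4 ->
  210 * a <= T * (1 + e + e ^+ 2 / 2 + e ^+ 3 / 6 + e ^+ 4 / 24) ^+ n ->
  210 * diagonal_cap lam <= T.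
Proof.
move=> l10 l0 ll l8 a0 aE e0 en hT.
apply: (@le_trans _ _ (210 * diagonal_cap l1)).
  by rewrite ler_pM2l //; exact: diagonal_cap_le.
rewrite /diagonal_cap aE /weight -mulrA -expRD.
have -> : - (3 / 4 * a) + (l1 / 4 - 3 / 4) = - (3 / 4 * (a + 1) - l1 / 4) by field.
rewrite expRN mulrA ler_pdivrMr ?expR_gt0 //.
have T0 : 0 <= T.
  have q0 : 0 < (1 + e + e ^+ 2 / 2 + e ^+ 3 / 6 + e ^+ 4 / 24) ^+ n.
    rewrite exprn_gt0 //; have := exprn_ge0 2 e0; have := exprn_ge0 3 e0; have := exprn_ge0 4 e0; lra.
  have : 0 <= T * (1 + e + e ^+ 2 / 2 + e ^+ 3 / 6 + e ^+ 4 / 24) ^+ n by apply: le_trans hT; lra.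
  by rewrite pmulr_lge0.
apply: (le_trans hT); rewrite ler_wpM2l //.
apply: (@le_trans _ _ (expR (n%:R * e))); last by rewrite ler_expR.
rewrite expRM_natl lerXn2r ?nnegrE ?expR_ge0 //; last exact: expR_ge_quartic.
have := exprn_ge0 2 e0; have := exprn_ge0 3 e0; have := exprn_ge0 4 e0; lra.
Qed.

Lemma diagonal_cap_low lam : 0 < lam -> lam <= 53 / 10 -> 210 * diagonal_cap lam <= 20.
Proof.
move=> l0 l1.
apply: (@diagonal_cap_le_taylor lam (53 / 10) (4 * (157 / 50) ^+ 2 / (53 / 10) - 1) (17 / 16) 4 20);
    [lra|exact: l0|exact: l1|lra|lra|reflexivity|lra|lra|lra].
Qed.

Lemma diagonal_cap_mid lam : 0 < lam -> lam <= 6 -> 210 * diagonal_cap lam <= 42.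
Proof.
move=> l0 l1.
apply: (@diagonal_cap_le_taylor lam 6 (4 * (157 / 50) ^+ 2 / 6 - 1) (17 / 10) 2 42);
    [lra|exact: l0|exact: l1|lra|lra|reflexivity|lra|lra|lra].
Qed.

Lemma diagonal_cap_high lam : 0 < lam -> lam <= 704 / 100 -> 210 * diagonal_cap lam <= 90.
Proof.
move=> l0 l1.
apply: (@diagonal_cap_le_taylor lam (704 / 100) (4 * (157 / 50) ^+ 2 / (704 / 100) - 1) (122 / 100) 2 90);
    [lra|exact: l0|exact: l1|lra|lra|reflexivity|lra|lra|lra].
Qed.

End DiagonalCap.

(** * The slope inequality at b = 157/50 *)

Section PairGap.
Variable R : realType.
Implicit Types (b t s c lam h H X a r : R).

(** The hypotheses on x and y, the two sides, bound h = lam eta / 2: large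
    asymmetry makes x too short or y longer than z. In terms of h these are
    the inequalities [xge'] and [yle'] below. *)
Lemma pade_gap_ge_diagonal_cap lam h c r : c = (157 / 50) ^+ 2 -> lam * r = 1 -> 0 <= h ->
  362 / 100 <= lam <= 704 / 100 ->
  47 / 50 <= lam / 4 + h ^+ 2 * r + c * r - 1 - h ->
  lam / 4 + h ^+ 2 * r + c * r + h <= lam ->
  210 * diagonal_cap lam <= pade_gap lam r (lam / 4 + c * r - 1) (h ^+ 2) * (1 + 3 / 10 * h ^+ 2).
Proof.
move=> cE lr h0 /andP[l0 l1] xge yle.
have lpos : 0 < lam by lra.
have r0 : 0 < r by nra.
have mulr a : lam * (a * r) = a by rewrite mulrCA lr mulr1.
have c_ge : 985 / 100 <= c by rewrite cE; lra.
have c_le : c <= 986 / 100 by rewrite cE; lra.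
have yle' : h ^+ 2 + lam * h <= 3 / 4 * lam ^+ 2 - c.
  have : lam * (lam / 4 + h ^+ 2 * r + c * r + h) <= lam * lam by rewrite ler_pM2l.
  rewrite !mulrDr !mulr; lra.
have xge' : 4 * (47 / 50 + 1) * lam - 4 * c <= (lam - 2 * h) ^+ 2.
  have : lam * (47 / 50) <= lam * (lam / 4 + h ^+ 2 * r + c * r - 1 - h) by rewrite ler_pM2l.
  rewrite !(mulrDr, mulrN) !mulr; lra.
have lX : lam * (lam / 4 + c * r - 1) = lam ^+ 2 / 4 + (157 / 50) ^+ 2 - lam.
  by rewrite !(mulrDr, mulrN) !mulr -cE; lra.
have hh : 2 * h <= lam by nra.
clear xge yle mulr.
have h20 : 0 <= h ^+ 2 by exact: sqr_ge0.
(* The three intervals of lam. In each, the gap exceeds the value of the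
   increasing right-hand side at the upper end. *)
have [l53|l53] := leP lam (53 / 10).
  apply: (@le_trans _ _ 20); first exact: diagonal_cap_low.
  have h164 : h <= 164 / 100 by nra.
  have := @pade_gap_low _ lam r (lam / 4 + c * r - 1) (h ^+ 2) lr lX.
  rewrite l0 l53 h20 /= => /(_ isT) P.
  have {}P : 20 <= pade_gap lam r (lam / 4 + c * r - 1) (h ^+ 2).
    apply: P; have [//|big] := leP (h ^+ 2) (165 / 100 * (lam - 362 / 100)).
    have hl : lam * h ^+ 2 <= 164 / 100 * (lam * h).
      have : lam * h * h <= lam * h * (164 / 100) by rewrite ler_wpM2l // mulr_ge0 // ltW.
      lra.
    have big' : lam * (165 / 100 * (lam - 362 / 100)) <= lam * h ^+ 2 by rewrite ler_pM2l // ltW.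
    clear lX xge'; have := sqr_ge0 (lam - 389 / 100); lra.
  by move: (pade_gap _ _ _ _) P => M P; nra.
have [l6|l6] := leP lam 6.
  apply: (@le_trans _ _ 42); first exact: diagonal_cap_mid.
  apply: pade_gap_mid => //; first by rewrite (ltW l53).
  rewrite h20 /=.
  have : h <= 19 / 10; last by nra.
  have [l55|l55] := leP lam (55 / 10); nra.
apply: (@le_trans _ _ 90); first exact: diagonal_cap_high.
apply: pade_gap_high => //; first by rewrite (ltW l6).
rewrite h20 /=.
have : h <= 167 / 100; last by nra.
nra.
Qed.

(** The diagonal w = 4 / z + z eta^2 grows with the asymmetry, and its term
    decays: the increment v of b w pays for the factor 1 + 3 h^2 / 10 by
    e^(-3 v / 4), and the remaining e^(-h) pays for D(h) / 105, whose coefficients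
    are below those of e^h. *)
Lemma diagonal_term_bound lam h c : c = (157 / 50) ^+ 2 -> 0 <= h ->
  362 / 100 <= lam <= 704 / 100 ->
  (4 * c / lam - 1 + 4 * h ^+ 2 / lam) * (1 + 3 / 10 * h ^+ 2) *
    expR (- (3 * c / lam - lam / 4 + h + 3 * h ^+ 2 / lam)) *
    (105 + 105 * h + 45 * h ^+ 2 + 10 * h ^+ 3 + h ^+ 4)
  <= 105 * diagonal_cap lam.
Proof.
move=> cE h0 /andP[l0 l1].
have lpos : 0 < lam by lra.
have [a aE] : exists a, a = 4 * c / lam - 1 by eexists.
have [v vE] : exists v, v = 4 * h ^+ 2 / lam by eexists.
have h20 : 0 <= h ^+ 2 by exact: sqr_ge0.
have a_ge : 23 / 5 <= a.
  by rewrite aE lerBrDr ler_pdivlMr // cE; nra.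
have v0 : 0 <= v by rewrite vE divr_ge0 //; lra.
rewrite -[4 * c / lam - 1]aE -[4 * h ^+ 2 / lam]vE.
have -> : - (3 * c / lam - lam / 4 + h + 3 * h ^+ 2 / lam) =
   (- (3 / 4 * a) + (lam / 4 - 3 / 4)) + (- h + - (3 / 4 * v)).
  by rewrite aE vE; field; lra.
rewrite expRD [expR (- h + _)]expRD.
have -> : diagonal_cap lam = a * expR (- (3 / 4 * a) + (lam / 4 - 3 / 4)).
  by rewrite /diagonal_cap -cE -aE /weight -mulrA -expRD.
move: (expR (- (3 / 4 * a) + (lam / 4 - 3 / 4))) (expR_gt0 (- (3 / 4 * a) + (lam / 4 - 3 / 4))) => K K0.
have hbound : (105 + 105 * h + 45 * h ^+ 2 + 10 * h ^+ 3 + h ^+ 4) * expR (- h) <= 105.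
  rewrite expRN ler_pdivrMr ?expR_gt0 //.
  have := expR_ge_quartic h0; have := exprn_ge0 3 h0; have := exprn_ge0 4 h0; lra.
have vbound : (a + v) * (1 + 3 / 10 * h ^+ 2) * expR (- (3 / 4 * v)) <= a.
  rewrite expRN ler_pdivrMr ?expR_gt0 //.
  (* With q = v / a: 1 + q <= e^q, and 3 h^2 / 10 is at most the remaining
     exponent 3 v / 4 - q. *)
  have [q qE] : exists q, q = v / a by eexists.
  have apos : 0 < a by lra.
  have vq : v = a * q by rewrite qE mulrCA divff ?mulr1 //; lra.
  have q0 : 0 <= q by rewrite qE divr_ge0 //; lra.
  have -> : expR (3 / 4 * v) = expR q * expR (3 / 4 * v - q) by rewrite -expRD; congr expR; ring.
  have qle : 3 / 10 * h ^+ 2 <= 3 / 4 * v - q.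
    have -> : h ^+ 2 = lam * v / 4 by rewrite vE; field; lra.
    have : a * lam * 3 / 10 * q / 4 <= (3 / 4 * a - 1) * q; last by rewrite vq; lra.
    have -> : a * lam * 3 / 10 * q / 4 = (a * lam * 3 / 40) * q by field.
    rewrite ler_wpM2r //.
    have al : a * lam = 4 * c - lam by rewrite aE; field; lra.
    rewrite al.
    suff : 0 <= lam * (3 / 4 * a - 1 - (4 * c - lam) * 3 / 40) by
      rewrite pmulr_rge0; clear - lpos; lra.
    have -> : lam * (3 / 4 * a - 1 - (4 * c - lam) * 3 / 40) =
      3 / 4 * (a * lam) - lam - lam * (4 * c - lam) * 3 / 40 by field.
    rewrite al cE; nra.
  have e1 := expR_ge1Dx q; have e2 := expR_ge1Dx (3 / 4 * v - q).
  have -> : a + v = a * (1 + q) by rewrite vq; ring.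
  by rewrite -mulrA ler_pM2l //; apply: ler_pM; clear - q0 h20 qle e1 e2; lra.
set D := _ + h ^+ 4 in hbound *.
have D0 : 0 <= D * expR (- h).
  rewrite mulr_ge0 ?expR_ge0 // /D.
  have := exprn_ge0 3 h0; have := exprn_ge0 4 h0; lra.
have := ler_pM _ D0 vbound hbound.
set V := _ * expR (- (3 / 4 * v)) => VD.
have V0 : 0 <= V by rewrite /V !mulr_ge0 ?expR_ge0 //; clear - a_ge v0 h20; lra.
have -> : (a + v) * (1 + 3 / 10 * h ^+ 2) * (K * (expR (- h) * expR (- (3 / 4 * v)))) * D =
  K * (V * (D * expR (- h))) by rewrite /V; ring.
have -> : 105 * (a * K) = K * (a * 105) by ring.
by rewrite ler_pM2l //; exact: VD.
Qed.

(** The slope inequality of [pair_gap_general] at b = 157/50, multiplied by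
    lam = b z and written in h = lam eta / 2 and c = b^2. The sides become
    b x = lam / 4 + h^2 / lam + c / lam - h and b y = b x + 2 h. *)
Lemma pair_gap lam h c : c = (157 / 50) ^+ 2 -> 0 <= h -> 362 / 100 <= lam <= 704 / 100 ->
  47 / 50 <= lam / 4 + h ^+ 2 / lam + c / lam - 1 - h ->
  lam / 4 + h ^+ 2 / lam + c / lam + h <= lam ->
  (lam + 2 * h) * (lam / 4 + h ^+ 2 / lam + c / lam - 1 + h) * expR (- (2 * h)) +
  8 * h * ((4 * c / lam - 1 + 4 * h ^+ 2 / lam) * expR (- (3 * c / lam - lam / 4 + h
      + 3 * h ^+ 2 / lam)))
  <= (lam - 2 * h) * (lam / 4 + h ^+ 2 / lam + c / lam - 1 - h).
Proof.
move=> cE h0 lam_range xge yle.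
have /andP[l0 l1] := lam_range.
have lpos : 0 < lam by lra.
have lr : lam * lam^-1 = 1 by rewrite divff //; lra.
have om := pade_gap_ge_diagonal_cap cE lr h0 lam_range xge yle.
have w := diagonal_term_bound cE h0 lam_range.
have h2pos : 0 <= 2 * h by lra.
have pade := expR_ge_pade h2pos.
set W := 4 * c / lam - 1 + 4 * h ^+ 2 / lam in w *.
set S := expR (- (3 * c / lam - lam / 4 + h + 3 * h ^+ 2 / lam)) in w *.
set D := 105 + 105 * h + 45 * h ^+ 2 + 10 * h ^+ 3 + h ^+ 4 in w.
have Dpos : 0 < D by clear - h0; rewrite /D; have := exprn_ge0 2 h0; have := exprn_ge0 3 h0;
    have := exprn_ge0 4 h0; lra.
(* Divided by 16, the Pade bound at 2 h reads D(h) <= e^(2h) D(-h). *)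
have {}pade : D * expR (- (2 * h)) <= 105 - 105 * h + 45 * h ^+ 2 - 10 * h ^+ 3 + h ^+ 4.
  rewrite expRN ler_pdivrMr ?expR_gt0 // /D; move: pade; clear; lra.
set D' := _ + h ^+ 4 in pade.
set P := lam / 4 + _ + _ - 1 - h in xge *.
have [Q QE] : exists Q, Q = lam / 4 + h ^+ 2 / lam + c / lam - 1 + h by eexists.
rewrite -QE.
have PQ : P = Q - 2 * h by rewrite QE /P; ring.
set M := pade_gap _ _ _ _ in om.
have key : (lam - 2 * h) * P * D - (lam + 2 * h) * Q * D' = 4 * h * M.
  rewrite PQ QE /M /pade_gap /D /D'; field; lra.
have H0 : 0 < 1 + 3 / 10 * h ^+ 2 by clear; have := sqr_ge0 h; lra.
have Qpos : 0 <= (lam + 2 * h) * Q by rewrite mulr_ge0 //; clear - lpos h0 PQ xge; lra.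
have step1 : (lam + 2 * h) * Q * (D * expR (- (2 * h))) <= (lam + 2 * h) * Q * D' by rewrite ler_wpM2l.
have step2 : 2 * (W * S * D) <= M.
  rewrite -(ler_pM2r H0); move: om w; clear; lra.
have step3 : 4 * h * (2 * (W * S * D)) <= 4 * h * M by
  rewrite ler_wpM2l //; clear - h0; lra.
rewrite -(ler_pM2r Dpos).
have -> : ((lam + 2 * h) * Q * expR (- (2 * h)) + 8 * h * (W * S)) * D =
  (lam + 2 * h) * Q * (D * expR (- (2 * h))) + 4 * h * (2 * (W * S * D)) by ring.
move: key step1 step3; clear; lra.
Qed.

End PairGap.

(** * Symmetrisation of two sides *)

Section Symmetrize.
Variable R : realType.
Implicit Types (b t s x y z w eta lam h : R).

(** This says that the sum of the weights at x, y and w is nondecreasing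
    in the asymmetry eta. Divided by (1 - eta) (b x - 1), the left-hand side is a
    sum of slope ratios, each of which decreases in b by [slope_ratio_le], so that
    the case b = 157/50 suffices. *)
Lemma pair_gap_general b z eta : 157 / 50 <= b -> 0 < z -> z <= 224 / 100 -> 0 <= eta <= 1 ->
  let x := z * (1 - eta) ^+ 2 / 4 + 1 / z in
  let y := z * (1 + eta) ^+ 2 / 4 + 1 / z in
  let w := 4 / z + z * eta ^+ 2 in
  31 / 50 <= x -> y <= z ->
  (1 + eta) * ((b * y - 1) * expR (- (b * (y - x)))) +
    4 * eta * ((b * w - 1) * expR (- (b * (w - x)))) <= (1 - eta) * (b * x - 1).
Proof.
move=> bge z0 z1 /andP[e0 e1] x y w xge yle.
have [b0 b0E] : exists b0 : R, b0 = 157 / 50 by eexists.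
(* As y <= z, already 1 <= 3/4 z^2: the side z is at least the hexagonal one. *)
have lam_lo : 362 / 100 <= b0 * z.
  have h1 : z / 4 + 1 / z <= z.
    apply: le_trans yle; rewrite /y lerD2r ler_pM2r ?invr_gt0 //.
    by rewrite ler_peMr ?(ltW z0) // exprn_ege1 //; lra.
  have : 1 <= 3 / 4 * z ^+ 2.
    have : z * (z / 4 + 1 / z) <= z * z by rewrite ler_pM2l.
    have -> : z * (z / 4 + 1 / z) = z ^+ 2 / 4 + 1 by field; lra.
    lra.
  rewrite b0E; nra.
have lam_hi : b0 * z <= 704 / 100 by rewrite b0E; lra.
have bz0 : 0 < b0 * z by lra.
have zn0 : z != 0 by lra.
have b0n0 : b0 != 0 by rewrite b0E; lra.
have hE : 0 <= b0 * z * eta / 2 by rewrite divr_ge0 // mulr_ge0 // ltW.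
have EX : b0 * z / 4 + (b0 * z * eta / 2) ^+ 2 / (b0 * z) + b0 ^+ 2 / (b0 * z) - b0 * z * eta / 2
    = b0 * x.
  by rewrite /x; field; rewrite zn0 b0n0.
have EY : b0 * z / 4 + (b0 * z * eta / 2) ^+ 2 / (b0 * z) + b0 ^+ 2 / (b0 * z) + b0 * z * eta / 2
    = b0 * y.
  by rewrite /y; field; rewrite zn0 b0n0.
have EW : 4 * b0 ^+ 2 / (b0 * z) + 4 * (b0 * z * eta / 2) ^+ 2 / (b0 * z) = b0 * w.
  by rewrite /w; field; rewrite zn0 b0n0.
have xy : x <= y by rewrite /x /y; nra.
have xw : x <= w.
  have z4 : z / 4 <= 3 / z by rewrite ler_pdivlMr //; nra.
  have : 0 <= z * eta by rewrite mulr_ge0 // ltW.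
  have : 0 <= z * eta ^+ 2 by rewrite mulr_ge0 ?sqr_ge0 // ltW.
  rewrite /x /w; lra.
have b0x : 1 < b0 * x by rewrite b0E; clear - xge; lra.
have lam_range : 362 / 100 <= b0 * z <= 704 / 100 by rewrite lam_lo.
have b0sq : b0 ^+ 2 = (157 / 50) ^+ 2 by rewrite b0E.
have := @pair_gap R (b0 * z) (b0 * z * eta / 2) (b0 ^+ 2) b0sq hE lam_range.
have -> : b0 * z / 4 + (b0 * z * eta / 2) ^+ 2 / (b0 * z)
    + b0 ^+ 2 / (b0 * z) - 1 - b0 * z * eta / 2 = b0 * x - 1 by lra.
have -> : b0 * z / 4 + (b0 * z * eta / 2) ^+ 2 / (b0 * z) + b0 ^+ 2 / (b0 * z) - 1
    + b0 * z * eta / 2 = b0 * y - 1 by lra.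
have -> : 4 * b0 ^+ 2 / (b0 * z) - 1 + 4 * (b0 * z * eta / 2) ^+ 2 / (b0 * z) = b0 * w - 1 by lra.
have -> : 2 * (b0 * z * eta / 2) = b0 * (y - x) by rewrite /y /x; field; rewrite zn0.
have -> : 3 * b0 ^+ 2 / (b0 * z) - b0 * z / 4 + b0 * z * eta / 2
    + 3 * (b0 * z * eta / 2) ^+ 2 / (b0 * z) = b0 * (w - x).
  by rewrite /w /x; field; rewrite zn0 b0n0.
have -> : 8 * (b0 * z * eta / 2) = b0 * z * (4 * eta) by field.
rewrite EY ler_pM2l; last by rewrite b0E; clear; lra.
have dE : b0 * (y - x) = b0 * z * eta by rewrite /y /x; field; rewrite zn0.
rewrite {1 3}dE => core.
have {core} : b0 * z * ((1 + eta) * (b0 * y - 1) * expR (- (b0 * (y - x))) +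
   4 * eta * ((b0 * w - 1) * expR (- (b0 * (w - x))))) <= b0 * z * ((1 - eta) * (b0 * x - 1)).
  have := core _ yle; rewrite b0E; clear - xge; lra.
rewrite ler_pM2l // => core.
have b0b : b0 <= b by rewrite b0E.
have x0 : 0 < x by clear - xge; lra.
have ry := slope_ratio_le b0b xy b0x x0.
have rw := slope_ratio_le b0b xw b0x x0.
have P0 : 0 < b0 * x - 1 by clear - b0x; lra.
have bx0 : 0 <= b * x - 1 by have := ler_wpM2r (ltW x0) b0b; clear - P0; lra.
rewrite -(ler_pM2r P0).
have h1 := ler_wpM2l (addr_ge0 ler01 e0) ry.
have h2 : 4 * eta * ((b * w - 1) * expR (- (b * (w - x))) * (b0 * x - 1)) <= 
  4 * eta * ((b0 * w - 1) * expR (- (b0 * (w - x))) * (b * x - 1)) by rewrite ler_wpM2l // mulr_ge0.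
have h3 := ler_wpM2r bx0 core.
move: h1 h2 h3; clear; lra.
Qed.

(** Triangles with one squared side z and fixed area are parametrised by the
    position eta of the foot of the height on that side, relative to its midpoint;
    x and y are the other two squared sides, z and w the squared diagonals of the
    parallelogram. Decreasing eta
    to 0 gives the isosceles triangle, and lowers the sum of weights. *)
Lemma weight_symmetrize b z eta : 157 / 50 <= b -> 0 < z -> z <= 224 / 100 -> 0 <= eta <= 1 ->
  31 / 50 <= z * (1 - eta) ^+ 2 / 4 + 1 / z -> z * (1 + eta) ^+ 2 / 4 + 1 / z <= z ->
  2 * weight b (z / 4 + 1 / z) + weight b (4 / z) <=
  weight b (z * (1 - eta) ^+ 2 / 4 + 1 / z) + weight b (z * (1 + eta) ^+ 2 / 4 + 1 / z)
    + weight b (4 / z + z * eta ^+ 2).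
Proof.
move=> bge z0 z1 /andP[e0 e1] xge yle.
pose x t := z * (1 - t) ^+ 2 / 4 + 1 / z.
pose y t := z * (1 + t) ^+ 2 / 4 + 1 / z.
pose w t := 4 / z + z * t ^+ 2.
pose g t := (1 - b * t) * expR (- (b * t)).
pose df t := - (z * (1 - t) / 2) * g (x t) + z * (1 + t) / 2 * g (y t) + 2 * z * t * g (w t).
have start : 2 * weight b (z / 4 + 1 / z) + weight b (4 / z) =
    weight b (x 0) + weight b (y 0) + weight b (w 0).
  rewrite /x /y /w subr0 addr0 expr1n expr0n !mulr0 addr0 !mulr1; ring.
rewrite start.
apply: (@le_of_derive_ge0 R (fun t => weight b (x t) + weight b (y t) + weight b (w t)) df 0 eta e0)
  => t /andP[t0 te].
  have dx : is_derive t 1 x (- (z * (1 - t) / 2)).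
    by apply: is_derive_eq; rewrite /GRing.scale /=; field.
  have dy : is_derive t 1 y (z * (1 + t) / 2).
    by apply: is_derive_eq; rewrite /GRing.scale /=; field.
  have dw : is_derive t 1 w (2 * z * t).
    by apply: is_derive_eq; rewrite /GRing.scale /=; field.
  by apply: is_deriveD; [apply: is_deriveD|]; apply: is_derive_weight.
have zt1 : z * (1 - eta) ^+ 2 <= z * (1 - t) ^+ 2.
  by rewrite ler_pM2l // lerXn2r ?nnegrE //; lra.
have zt2 : z * (1 + t) ^+ 2 <= z * (1 + eta) ^+ 2.
  by rewrite ler_pM2l // lerXn2r ?nnegrE //; lra.
have t01 : 0 <= t <= 1 by rewrite t0 (le_trans te).
have xt : 31 / 50 <= x t by rewrite /x; lra.
have yt : y t <= z by rewrite /y; lra.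
have gap := pair_gap_general bge z0 z1 t01 xt yt.
have shift s : g s = (1 - b * s) * expR (- (b * (s - x t))) * expR (- (b * x t)).
  by rewrite -mulrA -expRD; congr (_ * expR _); ring.
rewrite /df !shift subrr mulr0 oppr0 expR0.
move: gap; rewrite -/(x t) -/(y t) -/(w t).
set Y := expR (- (b * (y t - x t))); set W := expR (- (b * (w t - x t))).
set K := expR (- (b * x t)); have K0 : 0 < K := expR_gt0 _.
move=> gap.
have -> : - (z * (1 - t) / 2) * ((1 - b * x t) * 1 * K) +
   z * (1 + t) / 2 * ((1 - b * y t) * Y * K) + 2 * z * t * ((1 - b * w t) * W * K) =
   z * K / 2 * ((1 - t) * (b * x t - 1) - ((1 + t) * ((b * y t - 1) * Y) + 4 * t * ((b * w t - 1) * W))).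
  by field.
by rewrite mulr_ge0 ?subr_ge0 // divr_ge0 // mulr_ge0 // ltW.
Qed.

End Symmetrize.

(** * Isosceles triangles close to the equilateral one *)

Section IsoscelesLow.
Variable R : realType.
Implicit Types (b t s x y z w p k lam h Q : R).

(** The difference of the two sides is a concave quadratic polynomial in k, as
    its leading coefficient is - p (Q + 2). It is therefore enough to check the two
    ends of the interval of k, where it is a polynomial in p. *)
Lemma isosceles_poly c p k Q : c = (157 / 50) ^+ 2 -> 0 <= p <= 126 / 100 ->
  262 / 100 + 66 / 100 * p <= k <= 263 / 100 + 75 / 100 * p ->
  Q = 1 + p + p ^+ 2 / 2 + p ^+ 3 / 6 + p ^+ 4 / 24 ->
  2 * c * k + 2 * p * k * (k + 1) <= (2 * c - p * (k + 1)) * (k - p) * Q.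
Proof.
move=> cE /andP[p0 p1] /andP[k0 k1] QE.
pose E x := (2 * c - p * (x + 1)) * (x - p) * Q - 2 * c * x - 2 * p * x * (x + 1).
suff : 0 <= E k by rewrite /E; lra.
(* Powers of p are lowered by p <= 126/100, until linear arithmetic suffices. *)
have p2 : p ^+ 2 <= 126 / 100 * p by rewrite expr2 ler_wpM2r.
have p3 : p ^+ 3 <= 126 / 100 * p ^+ 2 by rewrite (exprS p 2) ler_wpM2r ?sqr_ge0.
have p4 : p ^+ 4 <= 126 / 100 * p ^+ 3 by rewrite (exprS p 3) ler_wpM2r ?exprn_ge0.
have p5 : p ^+ 5 <= 126 / 100 * p ^+ 4 by rewrite (exprS p 4) ler_wpM2r ?exprn_ge0.
have p6' : p ^+ 6 <= 126 / 100 * p ^+ 5 by rewrite (exprS p 5) ler_wpM2r ?exprn_ge0.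
have p6 : 0 <= p ^+ 6 by rewrite exprn_ge0.
have p7 : 0 <= p ^+ 7 by rewrite exprn_ge0.
have q2 : 0 <= p ^+ 2 by rewrite exprn_ge0.
have Elo : 0 <= E (262 / 100 + 66 / 100 * p).
  rewrite /E QE cE.
  lra.
have Ehi : 0 <= E (263 / 100 + 75 / 100 * p).
  rewrite /E QE cE.
  lra.
have Q0 : 0 <= Q by rewrite QE; clear - p0; have := exprn_ge0 2 p0; have := exprn_ge0 3 p0;
    have := exprn_ge0 4 p0; lra.
clear p2 p3 p4 p5 p6' p6 p7 q2 cE QE.
(* Interpolation between the ends, whose distance is 1/100 + 9/100 p; the last
   summand comes from the concavity of E. *)
have key : (1 / 100 + 9 / 100 * p) * E k =
  (263 / 100 + 75 / 100 * p - k) * E (262 / 100 + 66 / 100 * p) +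
  (k - (262 / 100 + 66 / 100 * p)) * E (263 / 100 + 75 / 100 * p) +
  (1 / 100 + 9 / 100 * p) * (p * (Q + 2)) * ((k - (262 / 100 + 66 / 100 * p)) * (263 / 100
      + 75 / 100 * p - k)).
  by rewrite /E; field.
have pos : 0 < 1 / 100 + 9 / 100 * p by lra.
rewrite -(pmulr_rge0 _ pos) key.
have d1 : 0 <= 263 / 100 + 75 / 100 * p - k by lra.
have d2 : 0 <= k - (262 / 100 + 66 / 100 * p) by lra.
apply: addr_ge0; first by apply: addr_ge0; exact: mulr_ge0.
apply: mulr_ge0; last exact: mulr_ge0.
by apply: mulr_ge0; [exact: ltW|apply: mulr_ge0; rewrite ?addr_ge0].
Qed.

Lemma is_derive_inv (s : R) : s != 0 -> is_derive s 1 (fun t : R => t^-1) (- s ^- 2).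
Proof.
move=> s0; apply: DeriveDef; first exact: derivableV.
by rewrite deriveV // derive_id /GRing.scale /= mulr1.
Qed.

(** By [slope_ratio_le] only b = 157/50 matters. With p = b (z - x) and
    k = b z - 1, where x = z / 4 + 1 / z, the relation between x and z eliminates z
    in favour of p and k: b^2 z^2 = 4/3 (b^2 + p (k + 1)). *)
Lemma isosceles_slope b z : 157 / 50 <= b -> 4 / 3 <= z ^+ 2 -> 0 < z -> z <= 145 / 100 ->
  (b * z - 1) * expR (- (b * (z - (z / 4 + 1 / z)))) <=
  2 * (1 / z ^+ 2 - 1 / 4) * (b * (z / 4 + 1 / z) - 1).
Proof.
move=> bge z2 z0 z1.
have [b0 b0E] : exists b0 : R, b0 = 157 / 50 by eexists.
have [x xE] : exists x, x = z / 4 + 1 / z by eexists.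
rewrite -xE.
have zx : z * x = z ^+ 2 / 4 + 1 by rewrite xE; field; lra.
have z115 : 115 / 100 <= z by nra.
have x0 : 0 < x by rewrite xE addr_gt0 // divr_gt0.
have xz : x <= z by rewrite -(ler_pM2l z0) zx; lra.
have x1 : 1 <= x by nra.
have b0b : b0 <= b by rewrite b0E.
have b0x : 1 < b0 * x by rewrite b0E; lra.
have ratio := slope_ratio_le b0b xz b0x x0.
have P0 : 0 < b0 * x - 1 by lra.
have bx0 : 0 <= b * x - 1 by nra.
rewrite -(ler_pM2r P0); apply: (le_trans ratio).
rewrite [leRHS]mulrAC; apply: (ler_wpM2r bx0).
have [p pE] : exists p, p = b0 * (z - x) by eexists.
have [k kE] : exists k, k = b0 * z - 1 by eexists.
have p0 : 0 <= p by rewrite pE mulr_ge0 //; lra.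
rewrite -pE expRN ler_pdivrMr; last exact: expR_gt0.
have zp : z * p = b0 * (3 / 4 * z ^+ 2 - 1).
  have -> : z * p = b0 * (z ^+ 2 - z * x) by rewrite pE; ring.
  by rewrite zx; field.
have p1 : p <= 126 / 100 by rewrite -(ler_pM2l z0) zp b0E; nra.
have k0 : 262 / 100 + 66 / 100 * p <= k.
  rewrite -(ler_pM2l z0) mulrDr [z * (66 / 100 * p)]mulrCA zp kE b0E.
  have := sqr_ge0 (z - 114 / 100); nra.
have k1 : k <= 263 / 100 + 75 / 100 * p.
  rewrite -(ler_pM2l z0) mulrDr [z * (75 / 100 * p)]mulrCA zp kE b0E; nra.
have b0sq : b0 ^+ 2 = (157 / 50) ^+ 2 by rewrite b0E.
have p_range : 0 <= p <= 126 / 100 by rewrite p0.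
have k_range : 262 / 100 + 66 / 100 * p <= k <= 263 / 100 + 75 / 100 * p by rewrite k0.
have := isosceles_poly b0sq p_range k_range erefl.
have := expR_ge_quartic p0.
set Q := 1 + p + _ + _ + _; set E := expR p => QE poly.
have s1 : b0 ^+ 2 * z ^+ 2 = 4 / 3 * (b0 ^+ 2 + p * (k + 1)).
  rewrite kE subrK; have -> : p * (b0 * z) = b0 * (z * p) by ring.
  by rewrite zp; field.
have z2p : 0 < z ^+ 2 by rewrite exprn_gt0.
have b2p : 0 < b0 ^+ 2 by rewrite exprn_gt0 // b0E; clear; lra.
have kp : b0 * x - 1 = k - p by rewrite kE pE; ring.
rewrite kp -kE.
have -> : 2 * (1 / z ^+ 2 - 1 / 4) * (k - p) * E =
   (2 * b0 ^+ 2 - p * (k + 1)) * (k - p) * E * (2 / (3 * b0 ^+ 2 * z ^+ 2)).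
  have -> : p * (k + 1) = 3 / 4 * (b0 ^+ 2 * z ^+ 2) - b0 ^+ 2 by rewrite s1; field.
  by field; clear - z0 b0E; lra.
have kk : k = (2 * b0 ^+ 2 * k + 2 * p * k * (k + 1)) * (2 / (3 * b0 ^+ 2 * z ^+ 2)).
  have -> : 2 * b0 ^+ 2 * k + 2 * p * k * (k + 1) = 2 * k * (b0 ^+ 2 + p * (k + 1)) by ring.
  have -> : b0 ^+ 2 + p * (k + 1) = 3 / 4 * (b0 ^+ 2 * z ^+ 2) by rewrite s1; field.
  by field; clear - z0 b0E; lra.
rewrite [leLHS]kk {kk}.
have F0 : 0 <= 2 / (3 * b0 ^+ 2 * z ^+ 2).
  by rewrite divr_ge0 // mulr_ge0 ?(ltW z2p) // mulr_ge0 ?(ltW b2p).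
rewrite ler_wpM2r //.
apply: (le_trans poly); rewrite ler_wpM2l //.
have kpos : 0 < k - p by rewrite -kp.
rewrite mulr_ge0 ?(ltW kpos) //.
have -> : p * (k + 1) = 3 / 4 * (b0 ^+ 2 * z ^+ 2) - b0 ^+ 2 by rewrite s1; field.
have -> : 2 * b0 ^+ 2 - (3 / 4 * (b0 ^+ 2 * z ^+ 2) - b0 ^+ 2) = 3 / 4 * b0 ^+ 2 * (4 - z ^+ 2) by field.
rewrite mulr_ge0 ?mulr_ge0 ?(ltW b2p) //; clear - z0 z1 b0E; nra.
Qed.

(** Equality holds at z = t, where the triangle is equilateral, and the
    right-hand side is nondecreasing in z by [isosceles_slope]. *)
Lemma weight_isosceles_low b t z : 157 / 50 <= b -> 0 < t -> t ^+ 2 = 4 / 3 -> t <= z ->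
    z <= 145 / 100 ->
  3 * weight b t <= 2 * weight b (z / 4 + 1 / z) + weight b z.
Proof.
move=> bge t0 tsq tz z1.
pose x s := s / 4 + 1 / s.
pose g s := (1 - b * s) * expR (- (b * s)).
pose df s := 2 * ((1 / 4 - 1 / s ^+ 2) * g (x s)) + g s.
have xt : x t = t.
  have tn0 : t != 0 by lra.
  apply: (mulfI tn0); rewrite /x mulrDr mulrA mulrCA divff // mulr1; lra.
have start : 3 * weight b t = 2 * weight b (x t) + weight b t by rewrite xt; ring.
rewrite start.
apply: (@le_of_derive_ge0 R (fun s => 2 * weight b (x s) + weight b s) df t z tz) => s /andP[ts sz].
  have s0 : s != 0 by lra.
  have dx : is_derive s 1 x (1 / 4 - 1 / s ^+ 2).
    have dinv := is_derive_inv s0.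
    have := is_deriveD (is_deriveZ 4^-1 (is_derive_id s 1)) dinv.
    rewrite /GRing.scale /= => D; rewrite /x.
    have -> : (fun s => s / 4 + 1 / s) = (fun t => 4^-1 * t) \+ (fun t => t^-1).
      by apply/funext => u /=; rewrite div1r mulrC.
    apply: is_derive_eq; by field.
  have dwx := is_derive_weight b dx.
  have dws := is_derive_weight b (is_derive_id s 1).
  apply: is_derive_eq.
  rewrite /df /g /GRing.scale /=; ring.
have s0 : 0 < s by lra.
have s2 : 4 / 3 <= s ^+ 2 by rewrite -tsq lerXn2r ?nnegrE //; lra.
have s145 : s <= 145 / 100 by lra.
have slope := isosceles_slope bge s2 s0 s145.
have split : g s = (1 - b * s) * expR (- (b * (s - x s))) * expR (- (b * x s)).
  by rewrite -mulrA -expRD; congr (_ * expR _); ring.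
rewrite /df split /g.
move: slope; rewrite -/(x s).
set E := expR (- (b * (s - x s))); set K := expR (- (b * x s)); have K0 : 0 < K := expR_gt0 _.
move=> slope.
have -> : 2 * ((1 / 4 - 1 / s ^+ 2) * ((1 - b * x s) * K)) + (1 - b * s) * E * K =
  K * (2 * (1 / s ^+ 2 - 1 / 4) * (b * x s - 1) - (b * s - 1) * E) by ring.
by rewrite mulr_ge0 ?subr_ge0 // ltW.
Qed.

End IsoscelesLow.

(** * Isosceles triangles far from the equilateral one *)

Section IsoscelesHigh.
Variable R : realType.
Implicit Types (b t s x y z w e m : R).

(** Convergents of the continued fraction of 2 / sqrt 3. *)
Lemma hex_side_bounds t : 0 < t -> t ^+ 2 = 4 / 3 -> 112 / 97 <= t <= 97 / 84.
Proof. by move=> t0 tsq; apply/andP; split; nra. Qed.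

(** The exponentials e^(-b x), e^(-b z), e^(-b w), relative to e^(-b t), are
    replaced by tangent lines at the reference points xm, m, wm, chosen near x, z
    and w. The resulting bound is affine in b, so it is enough to know its value at
    b = 157/50 and that its slope is nonnegative; multiplied by z^2 both are
    polynomial inequalities in z. The constant 603/200 is 3 (1 + 1/200), where the
    half per cent is for the tail of the hexagonal energy. *)
Lemma isosceles_high_piece b t z xm m wm e1 e2 e3 : 157 / 50 <= b -> 0 < t -> t ^+ 2 = 4 / 3 ->
  0 < z ->
  0 <= e1 -> 0 <= e2 -> 0 <= e3 ->
  e1 <= expR (157 / 50 * (112 / 97 - xm)) ->
  e2 <= expR (157 / 50 * (112 / 97 - m)) ->
  e3 <= expR (157 / 50 * (112 / 97 - wm)) ->
  603 / 200 * (97 / 84) * z ^+ 2 <=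
    2 * (z ^+ 2 / 4 + 1) * e1 * (z * (1 + 157 / 50 * xm) - 157 / 50 * (z ^+ 2 / 4 + 1)) +
    z ^+ 3 * e2 * (1 + 157 / 50 * (m - z)) + 4 * e3 * (z * (1 + 157 / 50 * wm) - 4 * (157 / 50)) ->
  0 <= 2 * (z ^+ 2 / 4 + 1) * e1 * (112 / 97 * z - (z ^+ 2 / 4 + 1)) + z ^+ 3 * e2 * (112 / 97 - z)
    + 4 * e3 * (112 / 97 * z - 4) ->
  603 / 200 * weight b t <= 2 * weight b (z / 4 + 1 / z) + weight b z + weight b (4 / z).
Proof.
move=> bge t0 tsq z0 e10 e20 e30 h1 h2 h3 value slope.
have /andP[t1 t2] := hex_side_bounds t0 tsq.
set x := z / 4 + 1 / z; set w := 4 / z.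
have zx : z ^+ 2 / 4 + 1 = z * x by rewrite /x; field; lra.
have zw : 4 = z * w by rewrite /w; field; lra.
have z2 : 0 < z ^+ 2 by rewrite exprn_gt0.
have {}value : 603 / 200 * (97 / 84) <=
    2 * x * e1 * (1 - 157 / 50 * (x - xm)) + z * e2 * (1 - 157 / 50 * (z - m)) +
    w * e3 * (1 - 157 / 50 * (w - wm)).
  rewrite -(ler_pM2r z2); apply: (le_trans value).
  rewrite zx zw; clear; lra.
have {}slope : 0 <= 2 * x * e1 * (112 / 97 - x) + z * e2 * (112 / 97 - z) + w * e3 * (112 / 97 - w).
  rewrite -(pmulr_lge0 _ z2); apply: (le_trans slope).
  rewrite zx zw; clear; lra.
have x0 : 0 < x by rewrite /x addr_gt0 // divr_gt0.
have w0 : 0 < w by rewrite /w divr_gt0.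
have dle c v : 157 / 50 * (v - c) + (b - 157 / 50) * (112 / 97 - c)
    <= b * (t - c) - 157 / 50 * (112 / 97 - v).
  have : b * (112 / 97) <= b * t by rewrite ler_pM2l //; clear - bge t1; lra.
  clear; lra.
have q1 := weight_tangent x0 e10 h1 (dle _ _).
have q2 := weight_tangent z0 e20 h2 (dle _ _).
have q3 := weight_tangent w0 e30 h3 (dle _ _).
set T := expR (- (b * t)) in q1 q2 q3.
have T0 : 0 < T := expR_gt0 _.
apply: (@le_trans _ _ (603 / 200 * (97 / 84) * T)).
  have -> : 603 / 200 * weight b t = 603 / 200 * t * T by rewrite /weight -/T; ring.
  by rewrite ler_pM2r //; clear - t2; lra.
apply: (@le_trans _ _ (2 * (x * e1 * (1 + (157 / 50 * (xm - x) + (b - 157 / 50) * (112 / 97 - x))) * T) +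
 z * e2 * (1 + (157 / 50 * (m - z) + (b - 157 / 50) * (112 / 97 - z))) * T +
 w * e3 * (1 + (157 / 50 * (wm - w) + (b - 157 / 50) * (112 / 97 - w))) * T)); last by move: q1 q2 q3;
     clear; lra.
have bs : 0 <= (b - 157 / 50) * (2 * x * e1 * (112 / 97 - x) + z * e2 * (112 / 97 - z)
    + w * e3 * (112 / 97 - w)).
  by rewrite mulr_ge0 // subr_ge0.
have key : 603 / 200 * (97 / 84) <=
  2 * (x * e1 * (1 + (157 / 50 * (xm - x) + (b - 157 / 50) * (112 / 97 - x)))) +
  z * e2 * (1 + (157 / 50 * (m - z) + (b - 157 / 50) * (112 / 97 - z))) +
  w * e3 * (1 + (157 / 50 * (wm - w) + (b - 157 / 50) * (112 / 97 - w))) by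
    move: value bs; clear; lra.
by have := ler_wpM2r (ltW T0) key; clear; lra.
Qed.

Lemma weight_isosceles_mid b t z : 157 / 50 <= b -> 0 < t -> t ^+ 2 = 4 / 3 ->
  145 / 100 <= z <= 2 ->
  603 / 200 * weight b t <= 2 * weight b (z / 4 + 1 / z) + weight b z + weight b (4 / z).
Proof.
move=> bge t0 tsq /andP[z0 z1].
have zpos : 0 < z by lra.
(* On a short interval the powers of z - l decrease geometrically, which makes
   the polynomial inequalities accessible to linear arithmetic. *)
have powers_chain l u : l <= z -> z <= u -> 0 <= z - l /\
   [/\ z - l <= u - l, (z - l) ^+ 2 <= (u - l) * (z - l),
    (z - l) ^+ 3 <= (u - l) * (z - l) ^+ 2 , (z - l) ^+ 4 <= (u - l) * (z - l) ^+ 3 & 0 <= (z - l) ^+ 4].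
  move=> lz zu; have d0 : 0 <= z - l by lra.
  have d1 : z - l <= u - l by lra.
  by split => //; split; rewrite ?exprn_ge0 // exprS ler_wpM2r // exprn_ge0.
have [zA|/ltW zA] := leP z (156 / 100).
  apply: (@isosceles_high_piece b t z (25 / 24) (3 / 2) (8 / 3) (2851 / 2000) (338 / 1000) (43 / 5000) bge t0 tsq zpos);
    [lra|lra|lra| | | | |].
  - apply: le_trans (expR_ge_quartic _); lra.
  - have -> : 157 / 50 * (112 / 97 - 3 / 2) = - (8%:R * (157 / 50 * (3 / 2 - 112 / 97) / 8)) :> R
      by field.
    apply: (@expRN_ge_pow _ 8); lra.
  - have -> : 157 / 50 * (112 / 97 - 8 / 3) = - (16%:R * (157 / 50 * (8 / 3 - 112 / 97) / 16)) :> R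
      by field.
    apply: (@expRN_ge_pow _ 16); lra.
  - have [d0 [d1 d2 d3 d4 d5]] := powers_chain (145 / 100) (156 / 100) z0 zA;
      clear - d0 d1 d2 d3 d4 d5; lra.
  - have [d0 [d1 d2 d3 d4 d5]] := powers_chain (145 / 100) (156 / 100) z0 zA;
      clear - d0 d1 d2 d3 d4 d5; lra.
have [zB|/ltW zB] := leP z (171 / 100).
  apply: (@isosceles_high_piece b t z (41 / 40) (8 / 5) (5 / 2) (1502 / 1000) (493 / 2000) (14 / 1000) bge t0 tsq zpos);
    [lra|lra|lra| | | | |].
  - apply: le_trans (expR_ge_quartic _); lra.
  - have -> : 157 / 50 * (112 / 97 - 8 / 5) = - (8%:R * (157 / 50 * (8 / 5 - 112 / 97) / 8)) :> R
      by field.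
    apply: (@expRN_ge_pow _ 8); lra.
  - have -> : 157 / 50 * (112 / 97 - 5 / 2) = - (8%:R * (157 / 50 * (5 / 2 - 112 / 97) / 8)) :> R
      by field.
    apply: (@expRN_ge_pow _ 8); lra.
  - have [d0 [d1 d2 d3 d4 d5]] := powers_chain (156 / 100) (171 / 100) zA zB;
      clear - d0 d1 d2 d3 d4 d5; lra.
  - have [d0 [d1 d2 d3 d4 d5]] := powers_chain (156 / 100) (171 / 100) zA zB;
      clear - d0 d1 d2 d3 d4 d5; lra.
  apply: (@isosceles_high_piece b t z (401 / 400) (46 / 25) (217 / 100) (1612 / 1000) (231 / 2000) (81 / 2000) bge t0 tsq zpos);
    [lra|lra|lra| | | | |].
  - apply: le_trans (expR_ge_quartic _); lra.
  - have -> : 157 / 50 * (112 / 97 - 46 / 25) = - (8%:R * (157 / 50 * (46 / 25 - 112 / 97) / 8)) :> R by field.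
    apply: (@expRN_ge_pow _ 8); lra.
  - have -> : 157 / 50 * (112 / 97 - 217 / 100) = - (8%:R * (157 / 50 * (217 / 100 - 112 / 97) / 8)) :> R by field.
    apply: (@expRN_ge_pow _ 8); lra.
  - have [d0 [d1 d2 d3 d4 d5]] := powers_chain (171 / 100) (2) zB z1; clear - d0 d1 d2 d3 d4 d5; lra.
  - have [d0 [d1 d2 d3 d4 d5]] := powers_chain (171 / 100) (2) zB z1; clear - d0 d1 d2 d3 d4 d5; lra.
Qed.

(** The rhombus with squared diagonals z and 4 / z is also the one with squared
    diagonals 4 / z and z, so z can be assumed to be at most 2. *)
Lemma weight_isosceles_high b t z : 157 / 50 <= b -> 0 < t -> t ^+ 2 = 4 / 3 ->
  145 / 100 <= z -> z <= 224 / 100 ->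
  603 / 200 * weight b t <= 2 * weight b (z / 4 + 1 / z) + weight b z + weight b (4 / z).
Proof.
move=> bge t0 tsq z0 z1.
have zpos : 0 < z by lra.
have [z2|/ltW z2] := leP z 2.
  have z02 : 145 / 100 <= z <= 2 by rewrite z0 z2.
  exact: (weight_isosceles_mid bge t0 tsq z02).
have w0 : 145 / 100 <= 4 / z by rewrite ler_pdivlMr //; lra.
have w1 : 4 / z <= 2 by rewrite ler_pdivrMr //; lra.
have w01 : 145 / 100 <= 4 / z <= 2 by rewrite w0 w1.
have := weight_isosceles_mid bge t0 tsq w01.
have -> : 4 / z / 4 + 1 / (4 / z) = z / 4 + 1 / z by field; lra.
have -> : 4 / (4 / z) = z by field; lra.
lra.
Qed.

End IsoscelesHigh.

(** * Lattices with a short vector *)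

Section ShortVectors.
Variable R : realType.
Implicit Types (b t s x y z w e m c : R).

(** Take the largest n with n^2 x <= 58/100; then (2 n)^2 x exceeds that
    bound. *)
Lemma exists_square_multiple x : 0 < x -> x <= 58 / 100 ->
  exists2 n : nat, (0 < n)%N & 145 / 1000 <= n%:R ^+ 2 * x <= 58 / 100.
Proof.
move=> x0 x1.
pose s := Num.sqrt (58 / 100 / x).
have s1 : 1 <= s.
  rewrite -[1]sqrtr1 ler_wsqrtr // ler_pdivlMr //; lra.
have s2 : s ^+ 2 * x = 58 / 100.
  rewrite sqr_sqrtr; first by field; lra.
  by rewrite divr_ge0 ?(ltW x0) //; lra.
have s0 : 0 <= s by lra.
have /andP[n1 n2] := truncn_itv s0.
set n := Num.truncn s in n1 n2.
have n0 : (0 < n)%N by rewrite truncn_gt0.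
exists n => //; apply/andP; split.
  have n1R : 1 <= n%:R :> R by rewrite ler1n.
  have s2n : s <= 2 * n%:R by rewrite -natr1 in n2; lra.
  have : s ^+ 2 <= (2 * n%:R) ^+ 2 by rewrite lerXn2r ?nnegrE //; lra.
  move/(ler_wpM2r (ltW x0)); rewrite s2; lra.
rewrite -s2 ler_wpM2r ?(ltW x0) // lerXn2r ?nnegrE //.
Qed.

(** For c below the hexagonal value the relative weight grows with b, hence
    is at least its value at b = 157/50. *)
Lemma weight_tangent_below b t c e m : 157 / 50 <= b -> 112 / 97 <= t -> 0 < c -> c <= 112 / 97 ->
  0 <= e -> e <= expR (157 / 50 * (112 / 97 - m)) ->
  c * e * (1 + 157 / 50 * (m - c)) * expR (- (b * t)) <= weight b c.
Proof.
move=> bge t1 c0 c1 e0 es; apply: (weight_tangent c0 e0 es).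
have : b * (112 / 97) <= b * t by rewrite ler_pM2l //; lra.
have : 157 / 50 * (112 / 97 - c) <= b * (112 / 97 - c) by rewrite ler_wpM2r // subr_ge0.
lra.
Qed.

(** Here c and 4 c stand for the values of the form at a multiple of the
    shortest vector and at twice that multiple. The second one is needed only when
    c is small. *)
Lemma weight_short_pair b t c : 157 / 50 <= b -> 0 < t -> t ^+ 2 = 4 / 3 ->
  145 / 1000 <= c -> c <= 58 / 100 ->
  603 / 200 * weight b t <= weight b c + weight b (4 * c).
Proof.
move=> bge t0 tsq c0 c1.
have /andP[t1 t2] := hex_side_bounds t0 tsq.
have cpos : 0 < c by lra.
have c112 : c <= 112 / 97 by lra.
have w4 : 0 <= weight b (4 * c) by rewrite /weight mulr_ge0 ?expR_ge0 // mulr_ge0 // ltW.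
have T0 := expR_gt0 (- (b * t)).
suff [K hK Kge] : exists2 K, K * expR (- (b * t))
    <= weight b c + weight b (4 * c) & 603 / 200 * (97 / 84) <= K.
  apply: le_trans hK; rewrite /weight mulrA ler_pM2r //.
  apply: le_trans Kge; rewrite ler_pM2l; [exact: t2|lra].
have [cA|cA] := leP c (16 / 100).
  have e1 : 18 <= expR (157 / 50 * (112 / 97 - 15 / 100)) :> R.
    by apply: le_trans (expR_ge_quartic _); lra.
  have e2 : 53 / 10 <= expR (157 / 50 * (112 / 97 - 61 / 100)) :> R.
    by apply: le_trans (expR_ge_quartic _); lra.
  have c4pos : 0 < 4 * c by lra.
  have c4 : 4 * c <= 112 / 97 by lra.
  have e10 : 0 <= 18 :> R by lra.
  have e20 : 0 <= 53 / 10 :> R by lra.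
  have h1 := weight_tangent_below bge t1 cpos c112 e10 e1.
  have h2 := weight_tangent_below bge t1 c4pos c4 e20 e2.
  exists (c * 18 * (1 + 157 / 50 * (15 / 100 - c)) + 4 * c * (53 / 10) * (1
      + 157 / 50 * (61 / 100 - 4 * c))).
    by rewrite mulrDl lerD.
  clear - c0 cA; nra.
have [cB|cB] := leP c (35 / 100).
  have e1 : 186 / 10 <= expR (157 / 50 * (112 / 97 - 22 / 100)) :> R.
    have -> : 157 / 50 * (112 / 97 - 22 / 100) = 3%:R * (157 / 150 * (112 / 97 - 22 / 100)) :> R
        by field.
    by apply: expR_ge_pow; lra.
  have e10 : 0 <= 186 / 10 :> R by lra.
  have h1 := weight_tangent_below bge t1 cpos c112 e10 e1.
  exists (c * (186 / 10) * (1 + 157 / 50 * (22 / 100 - c))); last by clear - cA cB; nra.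
  by apply: (le_trans h1); rewrite lerDl.
have e1 : 623 / 100 <= expR (157 / 50 * (112 / 97 - 57 / 100)) :> R.
  have -> : 157 / 50 * (112 / 97 - 57 / 100) = 2%:R * (157 / 100 * (112 / 97 - 57 / 100)) :> R by field.
  by apply: expR_ge_pow; lra.
have e10 : 0 <= 623 / 100 :> R by lra.
have h1 := weight_tangent_below bge t1 cpos c112 e10 e1.
exists (c * (623 / 100) * (1 + 157 / 50 * (57 / 100 - c))); last by clear - c1 cB; nra.
by apply: (le_trans h1); rewrite lerDl.
Qed.

Lemma weight_short_with_second b t x y : 157 / 50 <= b -> 0 < t -> t ^+ 2 = 4 / 3 ->
  58 / 100 <= x -> x <= 62 / 100 -> 1 <= y -> y <= 188 / 100 ->
  603 / 200 * weight b t <= weight b x + weight b y.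
Proof.
move=> bge t0 tsq x0 x1 y0 y1.
have /andP[t1 t2] := hex_side_bounds t0 tsq.
have xpos : 0 < x by lra.
have ypos : 0 < y by lra.
have T0 := expR_gt0 (- (b * t)).
have by1 : 1 <= b * y by nra.
have hy := weight_antitone ypos by1 y1.
have e1 : 568 / 100 <= expR (157 / 50 * (112 / 97 - 6 / 10)) :> R.
  have -> : 157 / 50 * (112 / 97 - 6 / 10) = 2%:R * (157 / 100 * (112 / 97 - 6 / 10)) :> R by field.
  by clear; apply: expR_ge_pow; lra.
have e2 : 1 / 10 <= expR (157 / 50 * (112 / 97 - 188 / 100)) :> R.
  have -> : 157 / 50 * (112 / 97 - 188 / 100) = - (8%:R * (157 / 50 * (188 / 100 - 112 / 97) / 8)) :> R by field.
  by clear; apply: expRN_ge_pow; lra.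
have e10 : 0 <= 568 / 100 :> R by lra.
have e20 : 0 <= 1 / 10 :> R by lra.
have y188 : 0 < 188 / 100 :> R by lra.
have dle c v : 157 / 50 * (v - c) + (b - 157 / 50) * (112 / 97 - c)
    <= b * (t - c) - 157 / 50 * (112 / 97 - v).
  have : b * (112 / 97) <= b * t by rewrite ler_pM2l //; clear - bge; lra.
  clear; lra.
have h1 := weight_tangent xpos e10 e1 (dle _ _).
have h2 := weight_tangent y188 e20 e2 (dle _ _).
have slope : 0 <= (b - 157 / 50) * (x * (568 / 100) * (112 / 97 - x)
    + 188 / 100 * (1 / 10) * (112 / 97 - 188 / 100)).
  apply: mulr_ge0; first by clear - bge; lra.
  clear - x0 x1; nra.
have key : 603 / 200 * (97 / 84) <=
  x * (568 / 100) * (1 + (157 / 50 * (6 / 10 - x) + (b - 157 / 50) * (112 / 97 - x))) +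
  188 / 100 * (1 / 10) * (1 + (157 / 50 * (188 / 100 - 188 / 100)
      + (b - 157 / 50) * (112 / 97 - 188 / 100))).
  have : 603 / 200 * (97 / 84) <= x * (568 / 100) * (1 + 157 / 50 * (6 / 10 - x)) + 188 / 100 * (1 / 10).
    by clear - x0 x1; nra.
  move: slope; clear; lra.
apply: (@le_trans _ _ (603 / 200 * (97 / 84) * expR (- (b * t)))).
  have -> : 603 / 200 * weight b t = 603 / 200 * t * expR (- (b * t)) by rewrite /weight; ring.
  by rewrite ler_pM2r // ler_pM2l; [exact: t2|clear; lra].
apply: (le_trans (ler_wpM2r (ltW T0) key)).
by rewrite mulrDl; apply: lerD; [exact: h1|apply: (le_trans h2)].
Qed.

End ShortVectors.

(** * Energy of a binary quadratic form *)

Section Forms.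
Variable R : realType.
Implicit Types (b t s x y z w e m c B : R) (p : int * int).

Definition qform x B y p : R :=
  x * p.1%:~R ^+ 2 + 2 * B * p.1%:~R * p.2%:~R + y * p.2%:~R ^+ 2.

Definition form_energy b x B y : \bar R :=
  \esum_(p in [set: int * int]) (weight b (qform x B y p))%:E.

Lemma qform_ge0 x B y p : 0 < x -> x * y - B ^+ 2 = 1 -> 0 <= qform x B y p.
Proof.
move=> x0 d; rewrite -(pmulr_rge0 _ x0) /qform.
move: (p.1%:~R) (p.2%:~R) => m n.
have -> : x * (x * m ^+ 2 + 2 * B * m * n + y * n ^+ 2)
    = (x * m + B * n) ^+ 2 + (x * y - B ^+ 2) * n ^+ 2 by ring.
by rewrite d mul1r addr_ge0 ?sqr_ge0.
Qed.

(** A change of basis of determinant 1 or -1 permutes the integer pairs. *)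
Lemma form_energy_unimodular b x B y (i j k l : int) : (i * l - j * k) ^+ 2 = 1 ->
  form_energy b (qform x B y (i, j))
    (x * i%:~R * k%:~R + B * (i%:~R * l%:~R + j%:~R * k%:~R) + y * j%:~R * l%:~R)
    (qform x B y (k, l)) = form_energy b x B y.
Proof.
move=> det1.
pose f p : int * int := (i * p.1 + k * p.2, j * p.1 + l * p.2).
pose g p : int * int := ((i * l - j * k) * (l * p.1 - k * p.2), (i * l - j * k) * (i * p.2 - j * p.1)).
have gK : cancel g f.
  move=> [a c]; rewrite /f /g /=; congr pair.
    have -> : i * ((i * l - j * k) * (l * a - k * c)) + k * ((i * l - j * k) * (i * c - j * a))
        = (i * l - j * k) ^+ 2 * a by ring.
    by rewrite det1 mul1r.
  have -> : j * ((i * l - j * k) * (l * a - k * c)) + l * ((i * l - j * k) * (i * c - j * a))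
      = (i * l - j * k) ^+ 2 * c by ring.
  by rewrite det1 mul1r.
have fK : cancel f g.
  move=> [a c]; rewrite /f /g /=; congr pair.
    have -> : (i * l - j * k) * (l * (i * a + k * c) - k * (j * a + l * c))
        = (i * l - j * k) ^+ 2 * a by ring.
    by rewrite det1 mul1r.
  have -> : (i * l - j * k) * (i * (j * a + l * c) - j * (i * a + k * c))
      = (i * l - j * k) ^+ 2 * c by ring.
  by rewrite det1 mul1r.
rewrite /form_energy (@reindex_esum R _ _ setT setT f (fun p => (weight b (qform x B y p))%:E));
    last first.
  split=> //; first by move=> p q _ _ /(can_inj fK).
  by move=> p _ /=; exists (g p).
apply: eq_esum => -[a c] _; congr (_%:E); congr weight.
rewrite /f /qform /= !rmorphD !rmorphM /=; ring.
Qed.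

Lemma esum_ge_seq (T : choiceType) (a : T -> \bar R) (r : seq T) : uniq r ->
  (\sum_(i <- r) a i <= \esum_(i in [set: T]) a i)%E.
Proof.
move=> ur; apply: esum_ge; exists [set` r]; first by split; [exact: finite_seq|].
by rewrite fsbig_seq.
Qed.

(** The rotation by pi / 3 in coordinates of a basis of two vectors of equal
    length at angle pi / 3. *)
Definition hexrot p : int * int := (- p.2, p.1 + p.2).

Lemma esum_hexrot (a : int * int -> \bar R) :
  \esum_(p in [set: int * int]) a (hexrot p) = \esum_(p in [set: int * int]) a p.
Proof.
rewrite [RHS](@reindex_esum R _ _ setT setT hexrot a) //; split=> //.
  by move=> [m n] [m' n'] _ _; rewrite /hexrot /= => -[]; move=> h1 h2; congr pair; lia.
by move=> [m n] _ /=; exists (m + n, - m); rewrite // /hexrot /=; congr pair; lia.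
Qed.

Definition hexnorm p : int := p.1 ^+ 2 + p.1 * p.2 + p.2 ^+ 2.

Lemma hexnorm_ge0 p : 0 <= hexnorm p.
Proof. by rewrite /hexnorm; nia. Qed.

(** The rotation permutes the integer pairs, so three times the energy of any
    form is the sum of the values along p, rho p and rho^2 p. *)
Lemma form_energy_orbits b t x B y : 0 < t -> 0 < x -> x * y - B ^+ 2 = 1 ->
  (forall p, 3 * weight b (t * (hexnorm p)%:~R) <= weight b (qform x B y p) +
     weight b (qform x B y (hexrot p)) + weight b (qform x B y (hexrot (hexrot p)))) ->
  (\esum_(p in [set: int * int]) (weight b (t * (hexnorm p)%:~R))%:E <= form_energy b x B y)%E.
Proof.
move=> t0 x0 d orb.
have w0 p : (0 <= (weight b (qform x B y p))%:E)%E by rewrite lee_fin weight_ge0 ?qform_ge0.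
have hex0 p : 0 <= (hexnorm p)%:~R :> R by rewrite ler0z hexnorm_ge0.
have h0 p : (0 <= (weight b (t * (hexnorm p)%:~R))%:E)%E
    by rewrite lee_fin weight_ge0 // mulr_ge0 // ltW.
set H := (X in (X <= _)%E).
set E := form_energy b x B y.
have E1 : \esum_(p in [set: int * int]) (weight b (qform x B y (hexrot p)))%:E = E.
  by rewrite (esum_hexrot (fun p => (weight b (qform x B y p))%:E)).
have E2 : \esum_(p in [set: int * int]) (weight b (qform x B y (hexrot (hexrot p))))%:E = E.
  by rewrite (esum_hexrot (fun p => (weight b (qform x B y (hexrot p)))%:E)).
have : (H + H + H <= E + E + E)%E.
  rewrite -{2}E1 -{2}E2 /E /form_energy /H -!esumD //;
    try by move=> p _; rewrite adde_ge0.
  by apply: le_esum => p _; rewrite -!EFinD lee_fin; apply: le_trans (orb p); lra.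
have H0 : (0 <= H)%E by apply: esum_ge0.
have E0 : (0 <= E)%E by apply: esum_ge0.
clear E1 E2; clearbody E H.
case: E E0 => [r _|_ _|]; [|by rewrite leey|by rewrite leeNy_eq].
case: H H0 => [h _|//|]; [|by rewrite leeNy_eq].
by rewrite -!EFinD !lee_fin; lra.
Qed.

End Forms.

(** * Reduction of binary quadratic forms *)

Section Reduction.
Variable R : realType.
Implicit Types (b t s x y z w e m c B : R) (p : int * int).

Lemma sqr_fst_le_qform x B y p : 0 < y -> x * y - B ^+ 2 = 1 -> p.1%:~R ^+ 2 <= y * qform x B y p.
Proof.
move=> y0 d; rewrite /qform; move: (p.1%:~R) (p.2%:~R) => m n.
have -> : y * (x * m ^+ 2 + 2 * B * m * n + y * n ^+ 2)
    = (y * n + B * m) ^+ 2 + (x * y - B ^+ 2) * m ^+ 2 by ring.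
by rewrite d mul1r lerDr sqr_ge0.
Qed.

Lemma sqr_snd_le_qform x B y p : 0 < x -> x * y - B ^+ 2 = 1 -> p.2%:~R ^+ 2 <= x * qform x B y p.
Proof.
move=> x0 d; rewrite /qform; move: (p.1%:~R) (p.2%:~R) => m n.
have -> : x * (x * m ^+ 2 + 2 * B * m * n + y * n ^+ 2)
    = (x * m + B * n) ^+ 2 + (x * y - B ^+ 2) * n ^+ 2 by ring.
by rewrite d mul1r lerDr sqr_ge0.
Qed.

Lemma int_le_of_sqr (i : int) (K : nat) (c : R) : i%:~R ^+ 2 <= c -> c < K%:R -> (`|i| < K)%N.
Proof.
move=> ic cK.
have : (i ^+ 2)%:~R < (K%:Z)%:~R :> R by rewrite rmorphXn /= (le_lt_trans ic).
rewrite ltr_int; nia.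
Qed.

(** Only bases with a sum of squared lengths at most x + y compete with the
    standard one, and the coordinates of their vectors are bounded, as q >= 0 has
    determinant 1. So the minimum is over a finite set of matrices. *)
Lemma exists_min_basis x B y : 0 < x -> x * y - B ^+ 2 = 1 ->
  exists i j k l : int, (i * l - j * k) ^+ 2 = 1 /\
    forall i' j' k' l' : int, (i' * l' - j' * k') ^+ 2 = 1 ->
      qform x B y (i, j) + qform x B y (k, l) <= qform x B y (i', j') + qform x B y (k', l').
Proof.
move=> x0 d.
have y0 : 0 < y.
  rewrite -(pmulr_rgt0 _ x0); have := sqr_ge0 B; lra.
pose K := (Num.truncn ((x + y) ^+ 2)).+1.
have K_gt : (x + y) ^+ 2 < K%:R.
  by have /andP[] := truncn_itv (sqr_ge0 (x + y)).
have box p : qform x B y p <= x + y -> (`|p.1| < K)%N /\ (`|p.2| < K)%N.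
  move=> qp; split; apply: (int_le_of_sqr _ K_gt).
    apply: le_trans (sqr_fst_le_qform p y0 d) _.
    apply: (@le_trans _ _ (y * (x + y))); first by rewrite ler_pM2l.
    by rewrite expr2 ler_pM2r; lra.
  apply: le_trans (sqr_snd_le_qform p x0 d) _.
  apply: (@le_trans _ _ (x * (x + y))); first by rewrite ler_pM2l.
  by rewrite expr2 ler_pM2r; lra.
(* Entries i with |i| < K are encoded by the ordinals i + K. *)
pose T := 'I_(K + K).
pose dec (o : T) : int := ((o : nat)%:Z - K%:Z)%R.
have decK (i : int) : (`|i| < K)%N -> exists o : T, dec o = i.
  move=> iK; have lt : (`|(i + K%:Z)%R| < K + K)%N by lia.
  exists (Ordinal lt); rewrite /dec /=; lia.
pose P (m : (T * T) * (T * T)) := (dec m.1.1 * dec m.2.2 - dec m.1.2 * dec m.2.1) ^+ 2 == 1.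
pose F (m : (T * T) * (T * T)) :=
  qform x B y (dec m.1.1, dec m.1.2) + qform x B y (dec m.2.1, dec m.2.2).
have q_id : qform x B y (1, 0) + qform x B y (0, 1) = x + y.
  by rewrite /qform /=; ring.
have [s1 E1] : exists o : T, dec o = 1.
  apply: decK; rewrite /K.
  have : 1 <= (x + y) ^+ 2.
    have : 1 <= x * y by have := sqr_ge0 B; lra.
    have := sqr_ge0 (x - y); have := sqr_ge0 x; have := sqr_ge0 y; nra.
  by rewrite -truncn_gt0 absz1 ltnS.
have [s0 E0] : exists o : T, dec o = 0 by apply: decK.
have P0 : P ((s1, s0), (s0, s1)) by rewrite /P /= E1 E0 mulr1 mulr0 subr0 expr1n.
case: (@Order.TotalTheory.arg_minP _ _ _ ((s1, s0), (s0, s1)) P F P0) => -[[a1 a2] [a3 a4]] Pa amin.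
exists (dec a1), (dec a2), (dec a3), (dec a4); split; first exact/eqP.
move=> i j k l dijkl.
have [le_xy|lt_xy] := leP (qform x B y (i, j) + qform x B y (k, l)) (x + y).
  have q1 := qform_ge0 (i, j) x0 d; have q2 := qform_ge0 (k, l) x0 d.
  have [/decK[si Ei] /decK[sj Ej]] : (`|i| < K)%N /\ (`|j| < K)%N by apply: (box (i, j)); lra.
  have [/decK[sk Ek] /decK[sl El]] : (`|k| < K)%N /\ (`|l| < K)%N by apply: (box (k, l)); lra.
  have := amin ((si, sj), (sk, sl)); rewrite /P /F /= Ei Ej Ek El dijkl eqxx.
  exact.
apply: le_trans (ltW lt_xy).
by have := amin _ P0; rewrite /F /= E0 E1 q_id.
Qed.

Lemma form_energy_swap b x B y : form_energy b x B y = form_energy b y B x.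
Proof.
have det1 : ((0 : int) * 0 - 1 * 1) ^+ 2 = 1 by [].
rewrite -(form_energy_unimodular b x B y det1).
have -> : qform x B y (0, 1) = y by rewrite /qform /=; ring.
have -> : qform x B y (1, 0) = x by rewrite /qform /=; ring.
by have -> : x * 0%:~R * 1%:~R + B * (0%:~R * 0%:~R + 1%:~R * 1%:~R) + y * 1%:~R * 0%:~R = B by ring.
Qed.

Lemma form_energy_opp b x B y : form_energy b x B y = form_energy b x (- B) y.
Proof.
have det1 : ((1 : int) * (-1) - 0 * 0) ^+ 2 = 1 by [].
rewrite -(form_energy_unimodular b x B y det1).
have -> : qform x B y (1, 0) = x by rewrite /qform /=; ring.
have -> : qform x B y (0, -1) = y by rewrite /qform /=; ring.
by have -> : x * 1%:~R * 0%:~R + B * (1%:~R * (-1)%:~R + 0%:~R * 0%:~R) + y * 0%:~R * (-1)%:~R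
    = - B by ring.
Qed.

(** A minimal basis (u, v) is compared with (u, v + u), (u, v - u),
    (u + v, v) and (u - v, v): this gives 2 |u.v| <= |u|^2 and 2 |u.v| <= |v|^2.
    Signs and order are then adjusted. *)
Lemma exists_reduced_form x B y : 0 < x -> x * y - B ^+ 2 = 1 ->
  exists x' B' y' : R, [/\ 0 < x', x' * y' - B' ^+ 2 = 1, 0 <= B', 2 * B' <= x' & x' <= y'] /\
    forall b, form_energy b x B y = form_energy b x' B' y'.
Proof.
move=> x0 d.
have y0 : 0 < y.
  rewrite -(pmulr_rgt0 _ x0); have := sqr_ge0 B; lra.
have [i [j [k [l [det1 minF]]]]] := exists_min_basis x0 d.
pose X := qform x B y (i, j); pose Y := qform x B y (k, l).
pose C := x * i%:~R * k%:~R + B * (i%:~R * l%:~R + j%:~R * k%:~R) + y * j%:~R * l%:~R.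
have det1R : (i%:~R * l%:~R - j%:~R * k%:~R) ^+ 2 = 1 :> R.
  by rewrite -!rmorphM -rmorphB -rmorphXn /= det1.
have D : X * Y - C ^+ 2 = 1.
  have -> : X * Y - C ^+ 2 = (x * y - B ^+ 2) * (i%:~R * l%:~R - j%:~R * k%:~R) ^+ 2.
    by rewrite /X /Y /C /qform /=; ring.
  by rewrite d det1R mul1r.
have X0 : 0 <= X by exact: qform_ge0.
have Y0 : 0 <= Y by exact: qform_ge0.
have Xpos : 0 < X.
  rewrite lt_neqAle X0 andbT eq_sym; apply/eqP => XE.
  by have := sqr_ge0 C; move: D; rewrite XE; lra.
have Ypos : 0 < Y.
  rewrite lt_neqAle Y0 andbT eq_sym; apply/eqP => YE.
  by have := sqr_ge0 C; move: D; rewrite YE; lra.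
have m1 : 0 <= X + 2 * C.
  have det2 : (i * (l + j) - j * (k + i)) ^+ 2 = 1.
    by rewrite -det1; congr (_ ^+ 2); ring.
  have := minF _ _ _ _ det2; rewrite -/X -/Y.
  have -> : qform x B y (k + i, l + j) = X + 2 * C + Y.
    by rewrite /X /Y /C /qform /= !rmorphD; ring.
  lra.
have m2 : 0 <= X - 2 * C.
  have det2 : (i * (l - j) - j * (k - i)) ^+ 2 = 1.
    by rewrite -det1; congr (_ ^+ 2); ring.
  have := minF _ _ _ _ det2; rewrite -/X -/Y.
  have -> : qform x B y (k - i, l - j) = X - 2 * C + Y.
    by rewrite /X /Y /C /qform /= !rmorphB; ring.
  lra.
have m3 : 0 <= Y + 2 * C.
  have det2 : ((i + k) * l - (j + l) * k) ^+ 2 = 1.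
    by rewrite -det1; congr (_ ^+ 2); ring.
  have := minF _ _ _ _ det2; rewrite -/X -/Y.
  have -> : qform x B y (i + k, j + l) = X + 2 * C + Y.
    by rewrite /X /Y /C /qform /= !rmorphD; ring.
  lra.
have m4 : 0 <= Y - 2 * C.
  have det2 : ((i - k) * l - (j - l) * k) ^+ 2 = 1.
    by rewrite -det1; congr (_ ^+ 2); ring.
  have := minF _ _ _ _ det2; rewrite -/X -/Y.
  have -> : qform x B y (i - k, j - l) = X - 2 * C + Y.
    by rewrite /X /Y /C /qform /= !rmorphB; ring.
  lra.
have E b : form_energy b x B y = form_energy b X C Y.
  by rewrite -(form_energy_unimodular b x B y det1).
have En b : form_energy b x B y = form_energy b X `|C| Y.
  rewrite E; have [C0|C0] := leP 0 C; first by rewrite ger0_norm.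
  by rewrite ltr0_norm // -form_energy_opp.
have Dn : X * Y - `|C| ^+ 2 = 1 by rewrite real_normK ?num_real.
have C0 : 0 <= `|C| by [].
have CX : 2 * `|C| <= X.
  by have : `|C| <= X / 2; [rewrite ler_norml; apply/andP; split|]; lra.
have CY : 2 * `|C| <= Y.
  by have : `|C| <= Y / 2; [rewrite ler_norml; apply/andP; split|]; lra.
have [XY|/ltW YX] := leP X Y; first by exists X, `|C|, Y.
exists Y, `|C|, X; split; first by split=> //; rewrite mulrC.
by move=> b; rewrite En form_energy_swap.
Qed.

End Reduction.

(** * Energy of the hexagonal form *)

Section HexTail.
Variable R : realType.
Implicit Types (b t s x y z w e m c B q r : R) (p : int * int).

Lemma esum_geometric_le r : 0 <= r < 1 ->
  (\esum_(i in [set: nat]) (r ^+ i)%:E <= ((1 - r)^-1)%:E)%E.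
Proof.
move=> /andP[r0 r1].
rewrite -nneseries_esumT; last by move=> n; rewrite lee_fin exprn_ge0.
apply: lime_le; first by apply: is_cvg_nneseries => n _ _; rewrite lee_fin exprn_ge0.
apply: nearW => n; rewrite sumEFin lee_fin -div1r ler_pdivlMr; last by lra.
rewrite mulrC.
have -> : (1 - r) * \sum_(0 <= i < n) r ^+ i = 1 - r ^+ n.
  by rewrite big_mkord -[in RHS](expr1n _ n) subrXX; congr (_ * _); apply: eq_bigr => i _;
      rewrite expr1n mul1r.
by rewrite lerBlDr lerDl exprn_ge0.
Qed.

Lemma esum_geometric2_le (c r : R) : 0 <= c -> 0 <= r < 1 ->
  (\esum_(ij in [set: nat * nat]) (c * (r ^+ ij.1 * r ^+ ij.2))%:E <= (c * (1 - r) ^- 2)%:E)%E.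
Proof.
move=> c0 r01; have /andP[r0 r1] := r01.
have -> : [set: nat * nat] = [set: nat] `*`` (fun=> [set: nat]) by apply/seteqP; split.
rewrite -(@esum_esum _ _ _ setT (fun=> setT) (fun i j => (c * (r ^+ i * r ^+ j))%:E)); last first.
  by move=> i j _ _; rewrite lee_fin !mulr_ge0 ?exprn_ge0.
have geo := esum_geometric_le r01.
have inv0 : 0 <= (1 - r)^-1 by rewrite invr_ge0; lra.
have scale (d : R) : 0 <= d -> (\esum_(i in [set: nat]) (d * r ^+ i)%:E <= (d * (1 - r)^-1)%:E)%E.
  move=> d0.
  rewrite -nneseries_esumT; last by move=> n; rewrite lee_fin mulr_ge0 ?exprn_ge0.
  under eq_eseriesr do rewrite EFinM.
  rewrite nneseriesZl; last by move=> n _; rewrite lee_fin exprn_ge0.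
  rewrite EFinM lee_wpmul2l ?lee_fin //.
  by rewrite nneseries_esumT // => n; rewrite lee_fin exprn_ge0.
apply: (@le_trans _ _ (\esum_(i in [set: nat]) (c * (1 - r)^-1 * r ^+ i)%:E)).
  apply: le_esum => i _.
  have h : 0 <= c * r ^+ i by rewrite mulr_ge0 ?exprn_ge0.
  apply: (@le_trans _ _ (c * r ^+ i * (1 - r)^-1)%:E).
    by apply: le_trans (scale _ h); apply: le_esum => j _; rewrite mulrA.
  by rewrite lee_fin; lra.
have h : 0 <= c * (1 - r)^-1 by rewrite mulr_ge0.
by apply: le_trans (scale _ h) _; rewrite lee_fin expr2 invfM mulrA.
Qed.

Lemma esum_setU_le (T : choiceType) (A B : set T) (a : T -> \bar R) : (forall i, 0 <= a i)%E ->
  (\esum_(i in A `|` B) a i <= \esum_(i in A) a i + \esum_(i in B) a i)%E.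
Proof.
move=> a0; rewrite (esumID A) //.
apply: leeD.
  by rewrite setUK.
rewrite [leRHS](esumID (~` A)) // -[leLHS]adde0; apply: leeD; last exact: esum_ge0.
by rewrite setIUl setICr set0U.
Qed.

(** The term N q^(N - 1) with N = 2 k + 1 + d: since 2 k + 1 <= 3^k and
    N <= (2 k + 1) 2^d, it is at most 3^k q^(2 k) (2 q)^d. *)
Lemma nat_weight_bound (k d : nat) q : 0 <= q -> q <= 1 / 2 ->
  (2 * k + 1 + d)%:R * q ^+ (2 * k + d) <= (3 * q ^+ 2) ^+ k.
Proof.
move=> q0 q1.
have h1 : (2 * k + 1 <= 3 ^ k)%N.
  by elim: k => [//|k IH]; rewrite expnS; lia.
have h2 : (2 * k + 1 + d <= (2 * k + 1) * 2 ^ d)%N.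
  by elim: d => [|d IH]; [lia|rewrite expnS; nia].
have -> : (2 * k + 1 + d)%:R * q ^+ (2 * k + d) = (2 * k + 1 + d)%:R * q ^+ d * (q ^+ 2) ^+ k.
  by rewrite exprD exprM mulrCA mulrC.
rewrite [leRHS]exprMn ler_wpM2r ?exprn_ge0 ?sqr_ge0 //.
apply: (@le_trans _ _ (((2 * k + 1) * 2 ^ d)%:R * (1 / 2) ^+ d)).
  by apply: ler_pM; rewrite ?exprn_ge0 // ?ler_nat // lerXn2r ?nnegrE //; lra.
rewrite natrM natrX -mulrA -exprMn.
have -> : 2 * (1 / 2) = 1 :> R by field.
by rewrite expr1n mulr1 -natrX ler_nat.
Qed.

(** One of six sectors of angle pi / 3, half open; its rotations partition the
    nonzero pairs. *)
Definition sector (ij : nat * nat) : int * int := ((ij.1.+1)%:Z, (ij.2)%:Z).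

Lemma hexnorm_hexrot p : hexnorm (hexrot p) = hexnorm p.
Proof. by rewrite /hexnorm /hexrot /=; ring. Qed.

Lemma hexrot_inj : injective hexrot.
Proof. by move=> [m n] [m' n']; rewrite /hexrot /= => -[] h1 h2; congr pair; lia. Qed.

Lemma sector_inj : injective sector.
Proof. by move=> [i j] [i' j']; rewrite /sector /= => -[] -> ->. Qed.

Lemma sectors_cover p : p = (0, 0) \/
  exists2 k : nat, (k < 6)%N & exists ij, p = iter k hexrot (sector ij).
Proof.
case: p => a c.
have : a = 0 /\ c = 0 \/ (0 < a /\ 0 <= c \/ (a <= 0 /\ 0 < a + c \/ (0 < c /\ a + c <= 0 \/
  (a < 0 /\ c <= 0 \/ (0 <= a /\ a + c < 0 \/ c < 0 /\ 0 <= a + c))))) by lia.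
have wit (k : nat) (m n : int) : 0 < m -> 0 <= n -> (k < 6)%N -> (a, c) = iter k hexrot (m, n) ->
    exists2 k : nat, (k < 6)%N & exists ij, (a, c) = iter k hexrot (sector ij).
  move=> m0 n0 k6 ->; exists k => //; exists (`|m|.-1, `|n|)%N; congr (iter k hexrot _).
  by rewrite /sector /=; congr pair; lia.
case=> [[-> ->]|]; first by left.
move=> sectors; right; move: sectors.
case=> [[h1 h2]|[[h1 h2]|[[h1 h2]|[[h1 h2]|[[h1 h2]|[h1 h2]]]]]].
- by apply: (wit 0%N a c); rewrite //; congr pair; lia.
- by apply: (wit 1%N (a + c) (- a)); rewrite //= /hexrot /=; try congr pair; lia.
- by apply: (wit 2%N c (- a - c)); rewrite //= /hexrot /=; try congr pair; lia.
- by apply: (wit 3%N (- a) (- c)); rewrite //= /hexrot /=; try congr pair; lia.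
- by apply: (wit 4%N (- a - c) a); rewrite //= /hexrot /=; try congr pair; lia.
- by apply: (wit 5%N (- c) (a + c)); rewrite //= /hexrot /=; try congr pair; lia.
Qed.

(** On the sector (i + 1)^2 + (i + 1) j + j^2 is at least 2 (i + j) + 1. *)
Lemma hexnorm_sector ij : exists d, hexnorm (sector ij) = (2 * (ij.1 + ij.2) + 1 + d)%:Z.
Proof.
case: ij => i j; exists (i * i + i * j + j * (j - 1))%N.
rewrite /hexnorm /sector /=.
case: j => [|j]; nia.
Qed.

Lemma hexnorm_iter_hexrot k p : hexnorm (iter k hexrot p) = hexnorm p.
Proof. by elim: k => //= k IH; rewrite hexnorm_hexrot. Qed.

Lemma esum_six_sectors_le (a : int * int -> \bar R) (C : R) : (forall p, 0 <= a p)%E -> a (0, 0) = 0%E ->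
  (forall k, \esum_(ij in [set: nat * nat]) a (iter k hexrot (sector ij)) <= C%:E)%E ->
  (\esum_(p in [set: int * int]) a p <= (6 * C)%:E)%E.
Proof.
move=> a0 a00 hC.
pose S k := [set iter k hexrot (sector ij) | ij in [set: nat * nat]].
have step n : (\esum_(p in [set p | exists2 k, (k < n)%N & S k p]) a p <= (n%:R * C)%:E)%E.
  elim: n => [|n IH].
    rewrite mul0r (_ : [set p | _] = set0) ?esum_set0 //.
    by apply/seteqP; split=> // p [].
  have -> : [set p | exists2 k, (k < n.+1)%N & S k p] = [set p | exists2 k, (k < n)%N & S k p] `|` S n.
    apply/seteqP; split=> p /=.
      move=> [k]; rewrite ltnS leq_eqVlt => /predU1P[->|kn] Sp; [by right|by left; exists k].
    by move=> [[k kn Sp]|Sp]; [exists k => //; exact: ltnW|exists n].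
  apply: le_trans (esum_setU_le _ _ a0) _.
  rewrite -natr1 mulrDl mul1r EFinD; apply: leeD => //.
  rewrite /S esum_image //.
  move=> ij ij' _ _; elim: n {IH} => [|n IH] /=; [exact: sector_inj|by move/hexrot_inj].
have -> : [set: int * int] = [set (0, 0)] `|` [set p | exists2 k, (k < 6)%N & S k p].
  apply/seteqP; split=> // p _ /=.
  case: (sectors_cover p) => [->|[k k6 [ij ->]]]; [by left|right; exists k => //; by exists ij].
apply: le_trans (esum_setU_le _ _ a0) _.
by rewrite esum_set1 ?a00 // add0e; exact: step.
Qed.

(** With q = e^(-b t), the value N of the form contributes G(t) N q^(N - 1).
    On each sector these terms are dominated by a double geometric series of ratio
    3 q^2, and q^2 <= 8/10000 makes its sum at most 1 + 1/200. *)
Lemma hex_energy_le b t : 157 / 50 <= b -> 0 < t -> t ^+ 2 = 4 / 3 ->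
  (\esum_(p in [set: int * int]) (weight b (t * (hexnorm p)%:~R))%:E
      <= (2 * (603 / 200 * weight b t))%:E)%E.
Proof.
move=> bge t0 tsq.
have /andP[t1 t2] := hex_side_bounds t0 tsq.
have [q qE] : exists q, q = expR (- (b * t)) by eexists.
have q0 : 0 <= q by rewrite qE expR_ge0.
have bt : 8 * (906 / 1000) <= 2 * (b * t) by nra.
have q2 : q ^+ 2 <= 8 / 10000.
  have -> : q ^+ 2 = (expR (2 * (b * t)))^-1.
    by rewrite qE -expRM_natl -expRN mulrN.
  have big : 1250 <= expR (2 * (b * t)).
    apply: (@le_trans _ _ (expR (8%:R * (906 / 1000)))); last by rewrite ler_expR.
    by apply: expR_ge_pow; lra.
  have E0 := expR_gt0 (2 * (b * t)).
  rewrite -div1r ler_pdivrMr; last exact: E0.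
  by move: big; clear; lra.
have q12 : q <= 1 / 2 by nra.
have r01 : 0 <= 3 * q ^+ 2 < 1 by apply/andP; split; [rewrite mulr_ge0 ?sqr_ge0|clear - q2; lra].
have w0 : 0 <= weight b t by rewrite weight_ge0 // ltW.
apply: (@le_trans _ _ (6 * (weight b t * (1 - 3 * q ^+ 2) ^- 2))%:E); last first.
  rewrite lee_fin.
  have -> : 2 * (603 / 200 * weight b t) = 6 * (weight b t * (201 / 200)) by field.
  rewrite ler_pM2l; last by clear; lra.
  apply: (ler_wpM2l w0).
  have pos : 0 < (1 - 3 * q ^+ 2) ^+ 2 by rewrite exprn_gt0 //; clear - q2; lra.
  rewrite -[_ ^- 2]div1r ler_pdivrMr; last exact: pos.
  have := sqr_ge0 q; clear - q2; nra.
apply: esum_six_sectors_le.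
- by move=> p; rewrite lee_fin weight_ge0 // mulr_ge0 ?(ltW t0) // ler0z hexnorm_ge0.
- have h0 : hexnorm (0, 0) = 0 by [].
  by rewrite h0 mulr0 /weight mul0r.
move=> k; apply: le_trans (esum_geometric2_le w0 r01).
apply: le_esum => ij _; rewrite lee_fin hexnorm_iter_hexrot.
have [d ->] := hexnorm_sector ij.
rewrite -exprD.
have -> : weight b (t * (2 * (ij.1 + ij.2) + 1 + d)%:Z%:~R) =
  weight b t * ((2 * (ij.1 + ij.2) + 1 + d)%:R * q ^+ (2 * (ij.1 + ij.2) + d)).
  rewrite /weight -pmulrn qE.
  have -> : - (b * (t * (2 * (ij.1 + ij.2) + 1 + d)%:R))
      = (2 * (ij.1 + ij.2) + 1 + d)%:R * (- (b * t)) by ring.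
  rewrite expRM_natl addnAC addn1 exprS; ring.
by rewrite ler_wpM2l //; exact: nat_weight_bound.
Qed.

End HexTail.

(** * Reduced forms *)

Section ReducedForms.
Variable R : realType.
Implicit Types (b t s x y z w e m c B q r : R) (p : int * int).

Definition opp_pair p : int * int := (- p.1, - p.2).

(** Opposite vectors have equal weights, hence the factor 2. *)
Lemma form_energy_ge_pairs b x B y (r : seq (int * int)) : uniq (r ++ map opp_pair r) ->
  ((2 * \sum_(p <- r) weight b (qform x B y p))%:E <= form_energy b x B y)%E.
Proof.
move=> ur; apply: le_trans (esum_ge_seq _ ur).
rewrite big_cat big_map /=.
have -> : (\sum_(p <- r) (weight b (qform x B y (opp_pair p)))%:E
    = \sum_(p <- r) (weight b (qform x B y p))%:E)%E.
  apply: eq_bigr => p _; congr (_%:E); congr weight; rewrite /qform /opp_pair /= !rmorphN; ring.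
by rewrite !sumEFin -EFinD lee_fin; lra.
Qed.

Lemma hexnorm_eq1 p : hexnorm p = 1 ->
  [\/ p = (1, 0), p = (0, 1), p = (-1, 1) | p = (-1, 0)] \/ (p = (0, -1) \/ p = (1, -1)).
Proof.
case: p => a c; rewrite /hexnorm /= => h.
have a1 : -1 <= a <= 1 by nia.
have c1 : -1 <= c <= 1 by nia.
have : (a = 1 /\ c = 0) \/ (a = 0 /\ c = 1) \/ (a = -1 /\ c = 1) \/ (a = -1 /\ c = 0)
    \/ (a = 0 /\ c = -1) \/ (a = 1 /\ c = -1) by nia.
case=> [[-> ->]|]; first by left; constructor 1.
case=> [[-> ->]|]; first by left; constructor 2.
case=> [[-> ->]|]; first by left; constructor 3.
case=> [[-> ->]|]; first by left; constructor 4.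
by case=> [[-> ->]|[-> ->]]; right; [left|right].
Qed.

(** With sigma = y + z the relation reads x (2 sigma - x) = 4 + (z - y)^2, and
    z - y <= 29/10 - sigma because z <= 145/100. A larger sum x + y + z would make
    the left-hand side too large. *)
Lemma reduced_sum_le t x y z : 0 < t -> t ^+ 2 = 4 / 3 -> 0 < x -> x <= y -> y <= z -> z <= 145 / 100 ->
  2 * (x * y + y * z + z * x) - (x ^+ 2 + y ^+ 2 + z ^+ 2) = 4 ->
  x + y + z <= 327 / 100 * t.
Proof.
move=> t0 tsq x0 xy yz z1 heron.
have /andP[t1 _] := hex_side_bounds t0 tsq.
(* 3775/1000 is below 327/100 * 112/97. *)
suff : x + y + z <= 3775 / 1000 by move: t1; clear; lra.
clear t0 tsq t1.
have [//|big] := leP (x + y + z) (3775 / 1000).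
have sigma : y + z <= 29 / 10 by lra.
have rel : x * (2 * (y + z) - x) = 4 + (z - y) ^+ 2 by lra.
have d1 : (z - y) ^+ 2 <= (29 / 10 - (y + z)) ^+ 2 by rewrite lerXn2r ?nnegrE //; lra.
have xb : 3775 / 1000 - (y + z) <= x by lra.
have : (3775 / 1000 - (y + z)) * (3 * (y + z) - 3775 / 1000) <= x * (2 * (y + z) - x) by nra.
nra.
Qed.

(** The parameters z and eta of [weight_symmetrize], read off from a form. *)
Lemma reduced_coordinates x B y (z := x + y - 2 * B) (eta := (y - x) / z) : 0 < z ->
    x * y - B ^+ 2 = 1 ->
  [/\ z * (1 - eta) ^+ 2 / 4 + 1 / z = x, z * (1 + eta) ^+ 2 / 4 + 1 / z = y &
      4 / z + z * eta ^+ 2 = x + y + 2 * B].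
Proof.
move=> z0 d.
have z_neq0 : z != 0 by lra.
have zE : x + y - 2 * B != 0 by [].
split; apply: (mulfI z_neq0).
- have -> : z * (z * (1 - eta) ^+ 2 / 4 + 1 / z) = ((z - (y - x)) / 2) ^+ 2 + (x * y - B ^+ 2).
    by rewrite d /eta; field.
  by rewrite /z; field.
- have -> : z * (z * (1 + eta) ^+ 2 / 4 + 1 / z) = ((z + (y - x)) / 2) ^+ 2 + (x * y - B ^+ 2).
    by rewrite d /eta; field.
  by rewrite /z; field.
have -> : z * (4 / z + z * eta ^+ 2) = 4 * (x * y - B ^+ 2) + (y - x) ^+ 2.
  by rewrite d /eta; field.
by rewrite /z; ring.
Qed.

(** The second inequality follows from the first because the diagonal
    x + y + 2 B is at least 4 / z and the weight decreases there. For reduced forms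
    with x >= 62/100 the side z stays below 224/100. *)
Lemma reduced_symmetrize b x B y (z := x + y - 2 * B) : 157 / 50 <= b ->
  x * y - B ^+ 2 = 1 -> 62 / 100 <= x -> x <= y -> y <= z -> z <= x + y ->
  [/\ z <= 224 / 100,
    2 * weight b (z / 4 + 1 / z) + weight b (4 / z)
        <= weight b x + weight b y + weight b (x + y + 2 * B) &
    2 * weight b (z / 4 + 1 / z) <= weight b x + weight b y].
Proof.
move=> bge d xge xy yz zxy.
have z0 : 0 < z by lra.
have B0 : 0 <= B by rewrite /z in zxy; lra.
have B1 : 2 * B <= x by rewrite /z in yz; lra.
have y2 : y <= 2.
  have : x * y <= 1 + x ^+ 2 / 4 by have : B ^+ 2 <= (x / 2) ^+ 2; [rewrite lerXn2r ?nnegrE //|]; lra.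
  have x2 : x <= 12 / 10 by nra.
  nra.
have z224 : z <= 224 / 100.
  have x2 : x <= 12 / 10 by nra.
  have : x * z <= x ^+ 2 + 1.
    have -> : x * z = x ^+ 2 + (1 + B ^+ 2) - 2 * x * B by rewrite /z; move: d; clear; lra.
    nra.
  nra.
pose eta := (y - x) / z.
have [E1 E2 E3] := reduced_coordinates z0 d.
have eta01 : 0 <= eta <= 1.
  by apply/andP; split; [rewrite divr_ge0 //|rewrite ler_pdivrMr //]; lra.
have := @weight_symmetrize R b z eta bge z0 z224 eta01.
rewrite -/z -/eta in E1 E2 E3.
rewrite E1 E2 E3 => sym; have xge' : 31 / 50 <= x by lra.
have {}sym := sym xge' yz.
split=> //.
have wz : 0 <= weight b (x + y + 2 * B) by rewrite weight_ge0 //; lra.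
have z4 : 0 < 4 / z by rewrite divr_gt0.
have h : 4 / z <= x + y + 2 * B.
  by rewrite -E3 lerDl mulr_ge0 ?sqr_ge0 // ltW.
have bz : 1 <= b * (4 / z).
  have : 1 <= 4 / z by rewrite ler_pdivlMr //; lra.
  by move=> h1; nra.
have := weight_antitone z4 bz h; lra.
Qed.

(** For pairs of norm 1 the triple consists of x, y and z = x + y - 2 B up to
    order, and the triangle is first made isosceles, then equilateral. From norm 2
    on, b t N >= 7 and the three values are close enough to t N to apply
    [weight_orbit_ge]. *)
Lemma hex_orbit_le b t x B y p : 157 / 50 <= b -> 0 < t -> t ^+ 2 = 4 / 3 ->
  x * y - B ^+ 2 = 1 -> 62 / 100 <= x -> x <= y -> y <= x + y - 2 * B -> x + y - 2 * B <= x + y ->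
  x + y - 2 * B <= 145 / 100 ->
  3 * weight b (t * (hexnorm p)%:~R) <= weight b (qform x B y p) +
     weight b (qform x B y (hexrot p)) + weight b (qform x B y (hexrot (hexrot p))).
Proof.
move=> bge t0 tsq d xge xy yz zxy zle.
have x0 : 0 < x by lra.
have [_ _ pair] := reduced_symmetrize bge d xge xy yz zxy.
have /andP[t1 t2] := hex_side_bounds t0 tsq.
have heron0 : 2 * (x * y + y * (x + y - 2 * B) + (x + y - 2 * B) * x)
    - (x ^+ 2 + y ^+ 2 + (x + y - 2 * B) ^+ 2) = 4 by move: d; clear; lra.
have sum_le := reduced_sum_le t0 tsq x0 xy yz zle heron0.
have tz : t <= x + y - 2 * B.
  have : t ^+ 2 <= (x + y - 2 * B) ^+ 2 by rewrite tsq; nra.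
  by rewrite ler_pXn2r ?nnegrE //; lra.
have first : 3 * weight b t <= weight b x + weight b y + weight b (x + y - 2 * B).
  have := weight_isosceles_low bge t0 tsq tz zle; lra.
have [N1|N1] := eqVneq (hexnorm p) 1.
  have q1 : qform x B y (1, 0) = x by rewrite /qform /=; ring.
  have q2 : qform x B y (0, 1) = y by rewrite /qform /=; ring.
  have q3 : qform x B y (-1, 1) = x + y - 2 * B by rewrite /qform /=; ring.
  have q4 : qform x B y (-1, 0) = x by rewrite /qform /=; ring.
  have q5 : qform x B y (0, -1) = y by rewrite /qform /=; ring.
  have q6 : qform x B y (1, -1) = x + y - 2 * B by rewrite /qform /=; ring.
  have r1 : hexrot (1, 0) = (0, 1) by [].
  have r2 : hexrot (0, 1) = (-1, 1) by [].
  have r3 : hexrot (-1, 1) = (-1, 0) by [].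
  have r4 : hexrot (-1, 0) = (0, -1) by [].
  have r5 : hexrot (0, -1) = (1, -1) by [].
  have r6 : hexrot (1, -1) = (1, 0) by [].
  rewrite N1 mulr1; apply: (le_trans first).
  case: (hexnorm_eq1 N1) => [[]|[]] ->.
  - by rewrite r1 r2 q1 q2 q3; lra.
  - by rewrite r2 r3 q2 q3 q4; lra.
  - by rewrite r3 r4 q3 q4 q5; lra.
  - by rewrite r4 r5 q4 q5 q6; lra.
  - by rewrite r5 r6 q5 q6 q1; lra.
  - by rewrite r6 r1 q6 q1 q2; lra.
have [N0|N0] := eqVneq (hexnorm p) 0.
  have wq p' : 0 <= weight b (qform x B y p') by rewrite weight_ge0 // qform_ge0.
  rewrite N0 mulr0 /weight mul0r mulr0; have := wq p; have := wq (hexrot p);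
      have := wq (hexrot (hexrot p)).
  rewrite /weight; lra.
have N2 : 2 <= hexnorm p by have := hexnorm_ge0 p; move: N1 N0; clear; lia.
pose N : R := (hexnorm p)%:~R.
have NR : 2 <= N by rewrite /N (_ : 2 = 2%:~R) // ler_int.
have NE : N = p.1%:~R ^+ 2 + p.1%:~R * p.2%:~R + p.2%:~R ^+ 2.
  by rewrite /N /hexnorm !rmorphD rmorphM !rmorphXn.
have sumE : qform x B y p + qform x B y (hexrot p) + qform x B y (hexrot (hexrot p))
    = N * (x + y + (x + y - 2 * B)).
  by rewrite NE /qform /hexrot /= !(rmorphD, rmorphN); ring.
have tN0 : 0 < t * N by rewrite mulr_gt0 //; lra.
have heron : 2 * (qform x B y p * qform x B y (hexrot p)
    + qform x B y (hexrot p) * qform x B y (hexrot (hexrot p))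
    + qform x B y (hexrot (hexrot p)) * qform x B y p)
    - (qform x B y p ^+ 2 + qform x B y (hexrot p) ^+ 2 + qform x B y (hexrot (hexrot p)) ^+ 2)
        = 3 * (t * N) ^+ 2.
  rewrite exprMn tsq.
  have -> : 3 * (4 / 3 * N ^+ 2) = 4 * (x * y - B ^+ 2) * N ^+ 2 by rewrite d; field.
  by rewrite NE /qform /hexrot /= !(rmorphD, rmorphN); ring.
have sumN : qform x B y p + qform x B y (hexrot p) + qform x B y (hexrot (hexrot p))
    <= 327 / 100 * (t * N).
  rewrite sumE mulrC mulrA ler_pM2r //; lra.
have bT : 7 <= b * (t * N).
  have : 112 / 97 * 2 <= t * N by clear - t1 NR; apply: ler_pM; lra.
  have : 157 / 50 * (t * N) <= b * (t * N) by rewrite ler_pM2r.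
  lra.
have Q0 p' : 0 <= qform x B y p' by exact: qform_ge0.
have R1 := heron_range tN0 heron (Q0 _) sumN.
have heron2 : 2 * (qform x B y (hexrot p) * qform x B y (hexrot (hexrot p))
    + qform x B y (hexrot (hexrot p)) * qform x B y p
    + qform x B y p * qform x B y (hexrot p))
    - (qform x B y (hexrot p) ^+ 2 + qform x B y (hexrot (hexrot p)) ^+ 2 + qform x B y p ^+ 2)
        = 3 * (t * N) ^+ 2.
  by rewrite -heron; ring.
have sumN2 : qform x B y (hexrot p) + qform x B y (hexrot (hexrot p)) + qform x B y p
    <= 327 / 100 * (t * N).
  by rewrite addrC addrA.
have R2 := heron_range tN0 heron2 (Q0 _) sumN2.
have heron3 : 2 * (qform x B y (hexrot (hexrot p)) * qform x B y p
    + qform x B y p * qform x B y (hexrot p)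
    + qform x B y (hexrot p) * qform x B y (hexrot (hexrot p)))
    - (qform x B y (hexrot (hexrot p)) ^+ 2 + qform x B y p ^+ 2 + qform x B y (hexrot p) ^+ 2)
        = 3 * (t * N) ^+ 2.
  by rewrite -heron; ring.
have sumN3 : qform x B y (hexrot (hexrot p)) + qform x B y p + qform x B y (hexrot p)
    <= 327 / 100 * (t * N).
  by rewrite -addrA addrC.
have R3 := heron_range tN0 heron3 (Q0 _) sumN3.
exact: weight_orbit_ge tN0 bT R1 R2 R3 heron.
Qed.

Lemma reduced_form_energy_ge b t x B y : 157 / 50 <= b -> 0 < t -> t ^+ 2 = 4 / 3 ->
  0 < x -> x * y - B ^+ 2 = 1 -> 0 <= B -> 2 * B <= x -> x <= y ->
  (\esum_(p in [set: int * int]) (weight b (t * (hexnorm p)%:~R))%:E <= form_energy b x B y)%E.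
Proof.
move=> bge t0 tsq x0 d B0 Bx xy.
have yz : y <= x + y - 2 * B by lra.
have zxy : x + y - 2 * B <= x + y by lra.
(* It is enough to find vectors, no two of them opposite, whose weights add up to
   half the bound for the hexagonal energy. *)
have few (r : seq (int * int)) : uniq (r ++ map opp_pair r) ->
    603 / 200 * weight b t <= \sum_(p <- r) weight b (qform x B y p) ->
    (\esum_(p in [set: int * int]) (weight b (t * (hexnorm p)%:~R))%:E <= form_energy b x B y)%E.
  move=> ur hr; apply: (le_trans (hex_energy_le bge t0 tsq)).
  apply: le_trans (form_energy_ge_pairs b x B y ur).
  by rewrite lee_fin ler_pM2l; [exact: hr|lra].
have q1 : qform x B y (1, 0) = x by rewrite /qform /=; ring.
have q2 : qform x B y (0, 1) = y by rewrite /qform /=; ring.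
have q3 : qform x B y (1, -1) = x + y - 2 * B by rewrite /qform /=; ring.
have q4 : qform x B y (1, 1) = x + y + 2 * B by rewrite /qform /=; ring.
have [xA|/ltW xA] := leP x (58 / 100).
  have [n n0 /andP[nlo nhi]] := exists_square_multiple x0 xA.
  apply: (few [:: (n%:Z, 0); ((2 * n)%:Z, 0)]).
    by rewrite /= !inE !xpair_eqE /opp_pair /=; clear - n0; lia.
  have -> : \sum_(p <- [:: (n%:Z, 0); ((2 * n)%:Z, 0)]) weight b (qform x B y p) =
      weight b (n%:R ^+ 2 * x) + weight b (4 * (n%:R ^+ 2 * x)).
    rewrite big_cons big_seq1; congr (weight b _ + weight b _).
      by rewrite /qform /= -pmulrn; ring.
    by rewrite /qform /= -pmulrn natrM; ring.
  exact: weight_short_pair.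
have [xB|/ltW xB] := leP x (62 / 100).
  apply: (few [:: (1, 0); (0, 1)]) => //.
  rewrite big_cons big_seq1 q1 q2.
  apply: weight_short_with_second => //.
    by have := sqr_ge0 B; nra.
  have : x * y <= 1 + x ^+ 2 / 4 by have : B ^+ 2 <= (x / 2) ^+ 2; [rewrite lerXn2r ?nnegrE //|]; lra.
  nra.
have [zA|/ltW zA] := leP (x + y - 2 * B) (145 / 100).
  apply: form_energy_orbits => // p.
  exact: hex_orbit_le.
have [z224 sym _] := reduced_symmetrize bge d xB xy yz zxy.
apply: (few [:: (1, 0); (0, 1); (1, -1); (1, 1)]) => //.
rewrite !big_cons big_nil q1 q2 q3 q4.
have := weight_isosceles_high bge t0 tsq zA z224.
lra.
Qed.

End ReducedForms.

(** * From lattices to forms *)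

Section Lattice.
Variable R : realType.
Implicit Types (u v p : 'rV[R]_2) (L : set 'rV[R]_2).

Definition dot u v : R := u 0 0 * v 0 0 + u 0 1 * v 0 1.

Lemma enorm_sqr p : enorm p ^+ 2 = dot p p.
Proof.
rewrite /enorm sqr_sqrtr; last by apply: sumr_ge0 => i _; exact: sqr_ge0.
by rewrite big_ord_recl big_ord1 /dot -!expr2; congr (_ + p 0 _ ^+ 2); apply/val_inj.
Qed.

Lemma det_mx2 (A : 'M[R]_2) : \det A = A 0 0 * A 1 1 - A 0 1 * A 1 0.
Proof.
rewrite (expand_det_row A 0) !big_ord_recl big_ord0 /cofactor !det_mx11 !mxE /=.
have entry (i j i' j' : 'I_2) : i = i' :> nat -> j = j' :> nat -> A i j = A i' j'.
  by move=> /val_inj -> /val_inj ->.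
rewrite (entry 0 ord0 0 0) // (entry 0 (lift ord0 ord0) 0 1) //.
rewrite (entry (lift 0 0) (lift ord0 0) 1 1) // (entry (lift 0 0) (lift (lift ord0 ord0) 0) 1 0) //.
rewrite !addn0 add0n expr0 expr1; ring.
Qed.

Lemma det_col_mx2 u v : \det (col_mx u v : 'M[R]_2) = u 0 0 * v 0 1 - u 0 1 * v 0 0.
Proof.
have rowu j : (col_mx u v : 'M[R]_2) 0 j = u 0 j.
  by rewrite -(col_mxEu u v 0 j); congr (col_mx u v _ j); apply/val_inj.
have rowv j : (col_mx u v : 'M[R]_2) 1 j = v 0 j.
  by rewrite -(col_mxEd u v 0 j); congr (col_mx u v _ j); apply/val_inj.
by rewrite det_mx2 !rowu !rowv.
Qed.

(** The Gram determinant is the square of the area. *)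
Lemma gram_det u v : cell_area u v = 1 -> dot u u * dot v v - dot u v ^+ 2 = 1.
Proof.
move=> area1.
have -> : dot u u * dot v v - dot u v ^+ 2 = (u 0 0 * v 0 1 - u 0 1 * v 0 0) ^+ 2.
  by rewrite /dot; ring.
by rewrite -det_col_mx2 -real_normK ?num_real // -[`|_|]/(cell_area u v) area1 expr1n.
Qed.

Lemma dot_gt0 u v : cell_area u v = 1 -> 0 < dot u u.
Proof.
move=> /gram_det d.
have : 0 <= dot u u by rewrite /dot -!expr2 addr_ge0 ?sqr_ge0.
rewrite le_eqVlt => /predU1P[uu|//].
by have := sqr_ge0 (dot u v); move: d; rewrite -uu mul0r; lra.
Qed.

Lemma dot_comb u v (m n : int) :
  dot (u *~ m + v *~ n) (u *~ m + v *~ n) = qform (dot u u) (dot u v) (dot v v) (m, n).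
Proof.
have entry i : (u *~ m + v *~ n) 0 i = m%:~R * u 0 i + n%:~R * v 0 i.
  by rewrite mxE -[u *~ m]scaler_int -[v *~ n]scaler_int !mxE.
by rewrite /dot /qform !entry; ring.
Qed.

(** The coordinates in the basis are determined by the lattice point, because
    the form of determinant 1 vanishes only at the origin. *)
Lemma lattice_energy_zspan alpha u v : cell_area u v = 1 ->
  lattice_energy alpha (zspan u v) = form_energy (pi * alpha) (dot u u) (dot u v) (dot v v).
Proof.
move=> area1; have d := gram_det area1; have u0 := dot_gt0 area1.
have v0 : 0 < dot v v.
  rewrite -(pmulr_rgt0 _ u0); have := sqr_ge0 (dot u v); lra.
pose f (p : int * int) := u *~ p.1 + v *~ p.2.
rewrite /lattice_energy (@reindex_esum R _ _ setT (zspan u v) f).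
  by apply: eq_esum => -[m n] _; rewrite enorm_sqr /f dot_comb.
split.
- by move=> [m n] _; exists m, n.
- move=> [m n] [m' n'] _ _ ff.
  have zero : f (m - m', n - n') = 0.
    by rewrite /f /= !mulrzBr addrACA -opprD; apply/eqP; rewrite subr_eq0; exact/eqP.
  have q0 : qform (dot u u) (dot u v) (dot v v) (m - m', n - n') = 0.
    by rewrite -dot_comb -[_ + _]/(f (m - m', n - n')) zero /dot !mxE; ring.
  have := sqr_fst_le_qform (m - m', n - n') v0 d; have := sqr_snd_le_qform (m - m', n - n') u0 d.
  rewrite q0 !mulr0 /=.
  move=> h1 h2.
  have e1 : (m - m')%:~R = 0 :> R by apply/eqP; rewrite -sqrf_eq0 eq_le h2 sqr_ge0.
  have e2 : (n - n')%:~R = 0 :> R by apply/eqP; rewrite -sqrf_eq0 eq_le h1 sqr_ge0.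
  by move/eqP: e1; move/eqP: e2; rewrite !intr_eq0 !subr_eq0 => /eqP -> /eqP ->.
by move=> p [m [n ->]]; exists (m, n).
Qed.

(** The squared length of the shortest vectors of the hexagonal lattice of unit
    area. *)
Definition hex_side : R := 2 / Num.sqrt 3.

Lemma hex_side_gt0 : 0 < hex_side.
Proof. by rewrite /hex_side divr_gt0 // sqrtr_gt0. Qed.

Lemma hex_side_sqr : hex_side ^+ 2 = 4 / 3.
Proof. rewrite /hex_side exprMn exprVn sqr_sqrtr //; by field. Qed.

Definition hexu : 'rV[R]_2 := Num.sqrt hex_side *: vec2 1 0.

Definition hexv : 'rV[R]_2 := Num.sqrt hex_side *: vec2 (1 / 2) (Num.sqrt 3 / 2).

Lemma hexagonal_zspan : hexagonal_lattice R = zspan hexu hexv.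
Proof.
apply/seteqP; split=> p.
  by move=> [q [m [n ->]] <-]; exists m, n; rewrite scalerDr /hexu /hexv !scalerMzr.
move=> [m [n ->]]; exists (vec2 1 0 *~ m + vec2 (1 / 2) (Num.sqrt 3 / 2) *~ n); first by exists m, n.
by rewrite scalerDr /hexu /hexv !scalerMzr.
Qed.

Lemma hexu_coord : hexu 0 0 = Num.sqrt hex_side /\ hexu 0 1 = 0.
Proof. by rewrite /hexu !mxE /= mulr1 mulr0. Qed.

Lemma hexv_coord : hexv 0 0 = Num.sqrt hex_side / 2 /\ hexv 0 1 = Num.sqrt hex_side * (Num.sqrt 3 / 2).
Proof. by rewrite /hexv !mxE /= mul1r. Qed.

Lemma hexagonal_area : cell_area hexu hexv = 1.
Proof.
rewrite /cell_area det_col_mx2; have [-> ->] := hexu_coord; have [-> ->] := hexv_coord.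
have -> : Num.sqrt hex_side * (Num.sqrt hex_side * (Num.sqrt 3 / 2)) - 0 * (Num.sqrt hex_side / 2) =
  Num.sqrt hex_side ^+ 2 * (Num.sqrt 3 / 2) by ring.
rewrite sqr_sqrtr ?(ltW hex_side_gt0) // /hex_side.
have s3 : Num.sqrt 3 != 0 :> R by rewrite gt_eqF // sqrtr_gt0.
have -> : 2 / Num.sqrt 3 * (Num.sqrt 3 / 2) = 1 :> R by field.
by rewrite normr1.
Qed.

Lemma hexagonal_unit_area : unit_area_lattice (hexagonal_lattice R).
Proof.
exists hexu, hexv; split; last exact: hexagonal_area.
split; last exact: hexagonal_zspan.
have side0 : 0 < Num.sqrt hex_side by rewrite sqrtr_gt0 hex_side_gt0.
have [u0 u1] := hexu_coord.
have v1 : 0 < hexv 0 1 by rewrite hexv_coord.2 mulr_gt0 // divr_gt0 // sqrtr_gt0.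
rewrite free_cons span_seq1 seq1_free; apply/andP; split.
  apply/negP => /vlineP[k ukv].
  have : hexu 0 1 = k * hexv 0 1 by rewrite ukv mxE.
  rewrite u1 => /esym/eqP; rewrite mulf_eq0 (gt_eqF v1) orbF => /eqP k0.
  by move: side0; rewrite -u0 ukv k0 scale0r mxE ltxx.
by apply/eqP => v0; move: v1; rewrite v0 mxE ltxx.
Qed.

Lemma hexagonal_energy alpha : lattice_energy alpha (hexagonal_lattice R) =
  \esum_(p in [set: int * int]) (weight (pi * alpha) (hex_side * (hexnorm p)%:~R))%:E.
Proof.
rewrite hexagonal_zspan lattice_energy_zspan; last exact: hexagonal_area.
apply: eq_esum => -[m n] _; congr (_%:E); congr weight.
have [u0 u1] := hexu_coord; have [v0 v1] := hexv_coord.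
have s2 : Num.sqrt hex_side ^+ 2 = hex_side by rewrite sqr_sqrtr // (ltW hex_side_gt0).
have s3 : Num.sqrt 3 ^+ 2 = 3 :> R by rewrite sqr_sqrtr.
have uu : dot hexu hexu = hex_side by rewrite /dot u0 u1 -!expr2 s2; ring.
have uv : dot hexu hexv = hex_side / 2.
  by rewrite /dot u0 u1 v0 v1 -[in RHS]s2; field.
have vv : dot hexv hexv = hex_side.
  rewrite /dot v0 v1.
  have -> : Num.sqrt hex_side / 2 * (Num.sqrt hex_side / 2) +
     Num.sqrt hex_side * (Num.sqrt 3 / 2) * (Num.sqrt hex_side * (Num.sqrt 3 / 2)) =
     Num.sqrt hex_side ^+ 2 * (1 + Num.sqrt 3 ^+ 2) / 4 by field.
  by rewrite s2 s3; field.
rewrite uu uv vv /qform /hexnorm /= !rmorphD rmorphM !rmorphXn /=; by field.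
Qed.

End Lattice.

Theorem corollary1p1 (R : realType) (alpha : R) (halpha : 1 <= alpha) :
  [/\ unit_area_lattice (hexagonal_lattice R),
      (lattice_energy alpha (hexagonal_lattice R) < +oo)%E
    & forall L : set 'rV[R]_2, unit_area_lattice L ->
        (lattice_energy alpha (hexagonal_lattice R)
           <= lattice_energy alpha L)%E].
Proof.
have bge : 157 / 50 <= pi * alpha.
  by apply: le_trans (pi_ge R) _; rewrite ler_peMr ?pi_ge0.
have t0 := hex_side_gt0 R; have tsq := hex_side_sqr R.
split; first exact: hexagonal_unit_area.
  rewrite hexagonal_energy; apply: le_lt_trans (hex_energy_le bge t0 tsq) _.
  exact: ltry.
move=> L [u [v [[_ ->] area1]]].
rewrite hexagonal_energy (lattice_energy_zspan alpha area1).
have [x [B [y [[x0 d B0 Bx xy] ->]]]] := exists_reduced_form (dot_gt0 area1) (gram_det area1).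
exact: reduced_form_energy_ge.
Qed.
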